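(* Let $n,d$ be positive integers. For any matrix $M\in\mathcal{M}(n,d)$ such that $\|M\|_d>0$ (i.e. $M$ is not diagonal) there exists a factorization $M=D\circ N$ such that $D$ is almost diagonal, $\|N\|_d<\|M\|_d$, and for any $L\prec N$ one has $D\circ L\prec M$.
   Context: $\mathcal{M}(n,d)$ is the set of $n\times n$ matrices with non-negative integer entries with total sum $d$. For $M=(m_{ij})\in\mathcal{M}(n,d)$ the diagonal norm is $\|M\|_d:=\sum_{1\le i,j\le n}|i-j|\,m_{ij}$. Let $V=\mathbb{C}^d$, $G=GL(V)$, and let $\mathcal{F}_n^d$ be the variety of partial flags $\{0\}=U_0\subset U_1\subset\dots\subset U_n=V$ (all possible dimensions, inclusions not necessarily strict). The orbits of the diagonal $G$-action on $\mathcal{F}_n^d\times\mathcal{F}_n^d$ are $\mathbb{O}_M$, $M\in\mathcal{M}(n,d)$, where $(\mathbf{U},\mathbf{W})\in\mathbb{O}_M$ iff $\dim U_a\cap W_b=\sum_{i\le a,\,j\le b}m_{ij}$ for all $a,b$. Bruhat order: $N\prec M$ iff $\mathbb{O}_N\subset\partial\mathbb{O}_M:=\overline{\mathbb{O}_M}\setminus\mathbb{O}_M$. Let $\mathbf{R}^M$, $\mathbf{C}^M$ be the vectors of row sums and column sums, and $\pi_{ij}:(\mathcal{F}_n^d)^3\to(\mathcal{F}_n^d)^2$ the projections. If $\mathbf{C}^M=\mathbf{R}^N$, the set $\pi_{13}(\pi_{12}^{-1}(\mathbb{O}_M)\cap\pi_{23}^{-1}(\mathbb{O}_N))$ is irreducible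 and $M\circ N$ is the matrix such that $\mathbb{O}_{M\circ N}$ is the unique orbit contained in and open in it; otherwise $M\circ N:=0$. A matrix in $\mathcal{M}(n,d)$ is almost diagonal if it is $\mathrm{Diag}(\mu)+E_{k,k+1}$ or $\mathrm{Diag}(\mu)+E_{k+1,k}$ for some $1\le k<n$ and $\mu\in\mathbb{Z}_{\ge0}^n$ with $\sum\mu_i=d-1$ ($E_{ij}$ matrix units). *)

(* Defs.v *)
From HB Require Import structures.
From mathcomp Require Import all_boot all_order all_algebra.
From mathcomp Require Import boolp classical_sets reals topology.
(* The notations of mpoly clash with those of topology. *)
From mathcomp Require Import(coercions,canonicals) mpoly.

Set Implicit Arguments.
Unset Strict Implicit.
Unset Printing Implicit Defensive.

Import GRing.Theory.
Local Open Scope classical_set_scope.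
Local Open Scope ring_scope.

Section Matrices.
Variable n : nat.
Implicit Types M N : 'M[nat]_n.

Definition Mset (d : nat) : {pred 'M[nat]_n} :=
  [pred M : 'M[nat]_n | (\sum_i \sum_j M i j)%N == d].

Definition row_sums M : 'rV[nat]_n := \row_i (\sum_j M i j)%N.

Definition col_sums M : 'rV[nat]_n := \row_j (\sum_i M i j)%N.

Definition diag_norm M : nat := (\sum_(i < n) \sum_(j < n) `|i - j| * M i j)%N.

Definition almost_diagonal (d : nat) M : Prop :=
  exists (mu : 'rV[nat]_n) (k l : 'I_n),
    [/\ (\sum_i mu 0%R i).+1 = d, l = k.+1 :> nat &
        M = diag_mx mu + delta_mx k l \/ M = diag_mx mu + delta_mx l k].

End Matrices.

Arguments Mset : clear implicits.

Section AffineZariski.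
Variables (F : fieldType) (m : nat).

Definition polyval (f : mpoly.mpoly m F) (x : 'rV[F]_m) : F :=
  mpoly.meval (x 0) f.

Definition affine_closed (Z : set 'rV[F]_m) : Prop :=
  exists S : set (mpoly.mpoly m F),
    Z = [set x | forall f, S f -> polyval f x = 0].

Lemma affine_closed0 : affine_closed set0.
Proof.
exists [set (1 : mpoly.mpoly m F)]; apply/seteqP; split=> x //= /(_ _ erefl)/eqP.
by rewrite /polyval mpoly.meval1 oner_eq0.
Qed.

Lemma affine_closedU (Y Z : set 'rV[F]_m) :
  affine_closed Y -> affine_closed Z -> affine_closed (Y `|` Z).
Proof.
move=> [S ->] [T ->].
exists [set h | exists f g, [/\ S f, T g & h = f * g]].
apply/seteqP; split=> x /=.
- move=> xST _ [f [g [Sf Tg ->]]]; rewrite /polyval mpoly.mevalM.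
  case: xST => [/(_ _ Sf)|/(_ _ Tg)]; rewrite /polyval => ->.
    by rewrite mul0r.
  by rewrite mulr0.
- move=> xST; apply: contrapT => /not_orP[/existsNP[f /not_implyP[Sf fx]]].
  move=> /existsNP[g /not_implyP[Tg gx]].
  have /eqP := xST (f * g) (ex_intro _ f (ex_intro _ g (And3 Sf Tg erefl))).
  by rewrite /polyval mpoly.mevalM mulf_eq0 => /orP[/eqP/fx|/eqP/gx].
Qed.

Lemma affine_closed_bigI (T : Type) (Z : T -> set 'rV[F]_m) :
  (forall i, affine_closed (Z i)) -> affine_closed (\bigcap_i Z i).
Proof.
move=> /choice[S ZS]; exists (\bigcup_i S i).
apply/seteqP; split=> x /=.
- by move=> Zx f [i _ Sf]; move: (Zx i I); rewrite ZS => /(_ _ Sf).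
- by move=> Sx i _; rewrite ZS => f Sf; apply: Sx; exists i.
Qed.

End AffineZariski.

Section Flags.
Variables (F : fieldType) (n d : nat).

Record flag := Flag {
  flag_space :> {ffun 'I_n.+1 -> {vspace 'rV[F]_d}};
  flagP : [&& flag_space ord0 == 0%VS, flag_space ord_max == fullv &
    [forall a : 'I_n.+1, forall b : 'I_n.+1,
       (a <= b)%N ==> (flag_space a <= flag_space b)%VS]] }.

HB.instance Definition _ := [isSub for flag_space].
HB.instance Definition _ := [Choice of flag by <:].

Definition flag2 : Type := (flag * flag)%type.
Definition flag3 : Type := (flag * flag * flag)%type.
HB.instance Definition _ := Choice.on flag2.

Definition pi12 (x : flag3) : flag2 := (x.1.1, x.1.2).
Definition pi23 (x : flag3) : flag2 := (x.1.2, x.2).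
Definition pi13 (x : flag3) : flag2 := (x.1.1, x.2).

(* The component of the flag variety with dimension vector [p] is the quotient
   of GL_d that sends [g] to the flag whose [a]-th space is spanned by the first
   [p a] rows of [g]; [adapted g U] says that [g] lies over [U]. *)
Definition adapted (g : 'M[F]_d) (U : flag) : Prop :=
  g \in unitmx /\
  forall a, U a = <<[seq row i g | i : 'I_d <- enum 'I_d & (i < \dim (U a))%N]>>%VS.

Definition coords (g h : 'M[F]_d) : 'rV[F]_(d * d + d * d) :=
  row_mx (mxvec g) (mxvec h).

(* The Zariski topology of the product of two flag varieties: on the component
   of dimension vectors [p] and [q] it is the quotient topology coming from
   GL_d x GL_d, itself a subspace of the affine space of pairs of matrices. *)
Definition zariski_closed (Z : set flag2) : Prop :=
  forall p q : 'I_n.+1 -> nat,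
  exists2 C : set 'rV[F]_(d * d + d * d), affine_closed C &
    forall (U W : flag) (g h : 'M[F]_d),
      (forall a, \dim (U a) = p a) -> (forall a, \dim (W a) = q a) ->
      adapted g U -> adapted h W -> Z (U, W) <-> C (coords g h).

Definition zariski_open (A : set flag2) : Prop := zariski_closed (~` A).

Lemma zariski_openT : zariski_open setT.
Proof.
by move=> p q; exists set0 => [|*]; [exact: affine_closed0|rewrite setCT].
Qed.

Lemma zariski_openI : setI_closed zariski_open.
Proof.
move=> A B oA oB p q; have [C cC AC] := oA p q; have [D cD BD] := oB p q.
exists (C `|` D); first exact: affine_closedU.
move=> U W g h Up Wq gU hW; rewrite setCI /setU /=.
have := AC _ _ _ _ Up Wq gU hW; have := BD _ _ _ _ Up Wq gU hW.
by rewrite /=; tauto.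
Qed.

Lemma zariski_open_bigU (T : Type) (A : T -> set flag2) :
  (forall i, zariski_open (A i)) -> zariski_open (\bigcup_i A i).
Proof.
move=> oA p q.
have /choice[C cC] : forall i, exists C : set 'rV[F]_(d * d + d * d),
    affine_closed C /\
    forall (U W : flag) (g h : 'M[F]_d),
      (forall a, \dim (U a) = p a) -> (forall a, \dim (W a) = q a) ->
      adapted g U -> adapted h W -> (~` A i) (U, W) <-> C (coords g h).
  by move=> i; have [C ? ?] := oA i p q; exists C.
exists (\bigcap_i C i); first by apply: affine_closed_bigI => i; case: (cC i).
move=> U W g h Up Wq gU hW; rewrite setC_bigcup; split=> AC i _.
- by apply/((cC i).2 _ _ _ _ Up Wq gU hW); exact: AC.
- by apply/((cC i).2 _ _ _ _ Up Wq gU hW); exact: AC.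
Qed.

HB.instance Definition _ := isOpenTopological.Build flag2
  zariski_openT zariski_openI zariski_open_bigU.

Lemma flag2_openE (A : set flag2) : open A = zariski_open A.
Proof. by []. Qed.

Lemma flag2_closedE (Z : set flag2) : closed Z <-> zariski_closed Z.
Proof. by rewrite -openC flag2_openE /zariski_open setCK. Qed.

(* Matrix indices start at 0 here, so the 1-based "i <= a" becomes "i < a". *)
Definition orb (M : 'M[nat]_n) : set flag2 :=
  [set UW : flag2 | forall a b : 'I_n.+1,
     \dim (UW.1 a :&: UW.2 b) =
     (\sum_(i < n | i < a) \sum_(j < n | j < b) M i j)%N].

Definition boundary (M : 'M[nat]_n) : set flag2 := closure (orb M) `\` orb M.

(* Membership in [Mset d] is required because [orb N] is empty when [N] is not
   in [Mset d], for instance when [N] is the value 0 of an undefined product. *)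
Definition bruhat_lt (N M : 'M[nat]_n) : Prop :=
  [/\ N \in Mset n d, M \in Mset n d & orb N `<=` boundary M].

Definition conv (M N : 'M[nat]_n) : set flag2 :=
  pi13 @` (pi12 @^-1` orb M `&` pi23 @^-1` orb N).

Definition open_orbit_in (S : set flag2) (K : 'M[nat]_n) : Prop :=
  [/\ K \in Mset n d, orb K `<=` S &
      exists2 A : set flag2, open A & orb K = S `&` A].

Definition circ (M N : 'M[nat]_n) : 'M[nat]_n :=
  if col_sums M == row_sums N then
    xget 0 [set K | open_orbit_in (conv M N) K /\
                    forall K', open_orbit_in (conv M N) K' -> K' = K]
  else 0.

End Flags.

(* Main.v *)
Require Import Defs.
From mathcomp Require Import all_boot all_order all_algebra.
From mathcomp Require Import boolp classical_sets cardinality topology.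
From mathcomp Require Import reals complex zify.
From mathcomp Require Import (coercions,canonicals) mpoly.

Set Implicit Arguments.
Unset Strict Implicit.
Unset Printing Implicit Defensive.

Import GRing.Theory Num.Theory.
Local Open Scope classical_set_scope.
Local Open Scope ring_scope.

(** Write U_a for the a-th space of a flag, number rows and columns from 0, and
    let [rk M a b] be the sum of the entries of [M] in rows below [a] and columns
    below [b]: the orbit of [M] is cut out by dim (U_a cap V_b) = rk M a b.

    Let l = k + 1.  For D = Diag(mu) + E_{k,l} the orbit of [D] consists of the
    pairs (U, W) that agree except that W_l is a hyperplane of U_l.  So the
    convolution of [D] and [N] consists of the (U, V) such that U arises from
    some (W, V) in the orbit of [N] by enlarging W_l by a line inside W_{l+1}.
    For a generic line, the intersections with the V_b grow as late as possible,
    namely at the last column [j] in which row [l] of [N] is nonzero.  Hence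
    [D o N] is obtained from [N] by moving one unit of column [j] from row [l] to
    row [k] ([circ_raise]).  For D = Diag(mu) + E_{l,k} a generic hyperplane of
    W_l containing W_k replaces W_l, and [D o N] is obtained by moving a unit of
    the first column in which row [k] is nonzero from row [k] to row [l]
    ([circ_lower]).

    Both computations rest on one criterion ([circ_eq]): if the orbit of [M] lies
    in the convolution and is dense in it, then [M] is the product.  That the
    orbit is then also open in the convolution is semicontinuity of
    dim (U_a cap V_b) ([closed_dim_cap]).  Density is shown along curves: a point
    (U, V) of the convolution with intermediate flag W is the value at t = 0 of
    (U (1 + tX), V), where X is a transvection preserving W that makes the new
    line or hyperplane generic for t <> 0 ([closure_curve]).

    Now let [M] have an entry above the diagonal.  Take the last column [j]
    containing such an entry, say at (k, j), and let [N] be [M] with that unit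
    moved down to row [l].  Row [l] of [N] vanishes after column [j], because
    an entry of [M] there would lie above the diagonal; so M = D o N, and the norm
    has dropped by one.  Let L be strictly below [N].  By [closure_conv] the orbit
    of [D o L] lies in the closure of the orbit of [M], and it remains to exclude
    D o L = M.  In that case L and [N] arise from [M] by moving down a unit
    of columns j' and [j] from row [k] to row [l].  The rank inequality between L
    and [N] gives j <= j', and M_{k,j'} > 0 gives j' <= j by the choice of [j].
    So L = [N], a contradiction.  A matrix with an entry below the diagonal is
    treated in the same way, with the first column containing one
    ([factor_upper], [factor_lower]). *)

(** * Closed subsets of affine space *)

Definition infinite_field (F : fieldType) := forall s : seq F, exists a, a \notin s.

Section Closed.
Variables (F : fieldType).

Lemma affine_closedT m : affine_closed (@setT 'rV[F]_m).
Proof. by exists set0; apply/seteqP; split=> x // _ f []. Qed.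

Lemma affine_closed_preim m1 m2 (B : 'M[F]_(m1, m2)) (C : set 'rV[F]_m2) :
  affine_closed C -> affine_closed [set x | C (x *m B)].
Proof.
move=> [S ->].
pose q := [tuple \sum_i mpoly.mpolyC m1 (B i j) * mpoly.mpolyX F (mpoly.mnm1 i) | j < m2].
exists [set mpoly.comp_mpoly q f | f in S].
have qE f x : polyval (mpoly.comp_mpoly q f) x = polyval f (x *m B).
  rewrite /polyval mpoly.comp_mpoly_meval; apply: mpoly.meval_eq => j.
  rewrite tnth_mktuple raddf_sum mxE /=; apply: eq_bigr => i _.
  by rewrite mpoly.mevalM mpoly.mevalC mpoly.mevalXU mulrC.
apply/seteqP; split=> x /= Sx f; last by move=> Sf; rewrite -qE; apply: Sx; exists f.
by move=> [g Sg <-]; rewrite qE; exact: Sx.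
Qed.

(** Compressions by arbitrary matrices replace the submatrices of the usual
    criterion by minors: the Gaussian elimination of [B] then provides a nonzero
    determinant at once. *)
Lemma mxrank_leP p q s (B : 'M[F]_(p, q)) :
  (\rank B <= s)%N <->
  forall (P : 'M[F]_(s.+1, p)) (Q : 'M[F]_(q, s.+1)), \det (P *m B *m Q) = 0.
Proof.
split=> [rB P Q|det0].
  apply: contraTeq rB => dn0; rewrite -ltnNge.
  have /mxrank_unit <- : P *m B *m Q \in unitmx by rewrite unitmxE unitfE.
  by rewrite (leq_trans (mxrankM_maxl _ _)) ?mxrankM_maxr.
rewrite leqNgt; apply/negP => rB.
have := det0 (pid_mx s.+1 *m invmx (col_ebase B)) (invmx (row_ebase B) *m pid_mx s.+1).
rewrite -{2}(mulmx_ebase B) !mulmxA mulmxKV ?col_ebase_unit //.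
rewrite mulmxK ?row_ebase_unit //.
rewrite !mul_pid_mx [X in pid_mx X](_ : _ = s.+1) ?pid_mx_1 ?det1 => [/eqP|].
  by rewrite oner_eq0.
have := rank_leq_row B; have := rank_leq_col B; lia.
Qed.

(** The determinants in [mxrank_leP] are polynomial in the entries. *)
Lemma affine_closed_rank m p q s (B : 'M[mpoly.mpoly m F]_(p, q)) :
  affine_closed [set x | \rank (map_mx (fun f => polyval f x) B) <= s]%N.
Proof.
pose c k l (A : 'M[F]_(k, l)) := map_mx (@mpoly.mpolyC m F) A.
exists [set f | exists P Q, f = \det (c s.+1 p P *m B *m c q s.+1 Q)].
have detE x P Q : polyval (\det (c s.+1 p P *m B *m c q s.+1 Q)) x =
    \det (P *m map_mx (fun f => polyval f x) B *m Q).
  have cK k l (A : 'M_(k, l)) : map_mx (mpoly.meval (x 0)) (c k l A) = A.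
    by apply/matrixP => i j; rewrite !mxE mpoly.mevalC.
  by rewrite /polyval -det_map_mx !map_mxM !cK.
apply/seteqP; split=> x /=.
  by move=> /mxrank_leP rB f [P [Q ->]]; rewrite detE rB.
by move=> det0; apply/mxrank_leP => P Q; rewrite -detE; apply: det0; exists P, Q.
Qed.

End Closed.

(** A polynomial restricts to a polynomial in [t] on the line, and one that
    vanishes at all nonzero [t] is zero because the field is infinite. *)
Lemma affine_closed_line (F : fieldType) m (C : set 'rV[F]_m) x y :
  infinite_field F ->
  affine_closed C -> (forall t, t != 0 -> C (x + t *: y)) -> C x.
Proof.
move=> Finf [S ->] Cxy f Sf.
pose q := mpoly.mmap (@polyC F) (fun i => (x 0 i)%:P + y 0 i *: 'X) f.
have qE t : q.[t] = polyval f (x + t *: y).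
  rewrite /polyval /mpoly.meval /q /mpoly.mmap horner_sum; apply: eq_bigr => a _.
  rewrite hornerM hornerC /mpoly.mmap1 horner_prod; congr (_ * _).
  by apply: eq_bigr => i _; rewrite horner_exp !hornerE !mxE mulrC.
have -> : polyval f x = q.[0] by rewrite qE scale0r addr0.
suff -> : q = 0 by rewrite horner0.
have [s [us sz s0]] : exists s : seq F, [/\ uniq s, size s = size q & 0 \notin s].
  elim: (size q) => [|p [s [us sz s0]]]; first by exists [::].
  have [a] := Finf (0 :: s); rewrite inE negb_or => /andP[a0 as_].
  by exists (a :: s); rewrite /= as_ us sz inE negb_or eq_sym a0 s0.
apply: (@roots_geq_poly_eq0 _ _ s) => //; last by rewrite sz.
apply/allP => t ts; apply/rootP; rewrite qE; apply: Cxy => //.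
by apply: contraNneq s0 => <-.
Qed.

(** * Row spaces as subspaces *)

Section RowSpan.
Variables (F : fieldType) (d : nat).

Definition rowspan m (A : 'M[F]_(m, d)) : {vspace 'rV[F]_d} :=
  <<[seq row i A | i : 'I_m]>>%VS.

Lemma mem_rowspan m (A : 'M[F]_(m, d)) v : (v \in rowspan A) = (v <= A)%MS.
Proof.
apply/idP/idP => [|/submxP[u ->]].
  move=> /coord_span ->; apply: summx_sub => i _; apply: scalemx_sub.
  have : [seq row i A | i : 'I_m]`_i \in [seq row i A | i : 'I_m] by rewrite mem_nth ?size_tuple.
  by case/mapP => j _ ->; exact: row_sub.
rewrite mulmx_sum_row; apply: memv_suml => i _; apply/memvZ/memv_span.
by apply: map_f; rewrite mem_enum.
Qed.

Lemma rowspanS m p (A : 'M_(m, d)) (B : 'M_(p, d)) :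
  (rowspan A <= rowspan B)%VS = (A <= B)%MS.
Proof.
apply/idP/idP => [/subvP AB|AB].
  by apply/row_subP => i; rewrite -mem_rowspan AB // mem_rowspan row_sub.
by apply/subvP => v; rewrite !mem_rowspan => /submx_trans; apply.
Qed.

Lemma rowspan_col m p (A : 'M_(m, d)) (B : 'M_(p, d)) :
  rowspan (col_mx A B) = (rowspan A + rowspan B)%VS.
Proof.
apply/eqP; rewrite eqEsubv subv_add !rowspanS andbC.
rewrite -!addsmxE addsmxSl addsmxSr /=; apply/subvP => v.
rewrite mem_rowspan -addsmxE => /sub_addsmxP[[u w] /= ->].
by apply: memv_add; rewrite mem_rowspan submxMl.
Qed.

(** Both [A] and its complement span spaces of dimension at most their rank,
    while together they span everything, so neither inequality is strict. *)
Lemma dim_rowspan m (A : 'M[F]_(m, d)) : \dim (rowspan A) = \rank A.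
Proof.
have le p (B : 'M[F]_(p, d)) : (\dim (rowspan B) <= p)%N.
  by rewrite (leq_trans (dim_span _)) // size_image card_ord.
have base p (B : 'M[F]_(p, d)) : rowspan (row_base B) = rowspan B.
  by apply/eqP; rewrite eqEsubv !rowspanS !eq_row_base submx_refl.
have rle p (B : 'M[F]_(p, d)) : (\dim (rowspan B) <= \rank B)%N.
  by rewrite -base le.
apply/eqP; rewrite eqn_leq rle /=.
have full : rowspan (col_mx A (A^C)%MS) = fullv.
  apply/vspaceP => v; rewrite mem_rowspan memvf -addsmxE.
  by apply: submx_full; exact: addsmx_compl_full.
have := dimv_add_leqif (rowspan A) (rowspan (A^C)%MS).
rewrite -rowspan_col full dimvf => -[+ _].
have -> : dim 'rV[F]_d = d by rewrite /dim /= mul1n.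
have := rle _ (A^C)%MS; rewrite mxrank_compl; have := rank_leq_col A; lia.
Qed.

End RowSpan.

(** * Frames adapted to a flag *)

Lemma takeEfilter (T : Type) (x0 : T) s q :
  take q s = [seq nth x0 s i | i <- iota 0 (size s) & (i < q)%N].
Proof.
elim: s q => [|x s IHs] [|q] //=; first by rewrite (eq_filter (a2 := pred0)) ?filter_pred0.
rewrite IHs; congr (_ :: _).
by rewrite -[1%N]addn0 iotaDl filter_map -map_comp; apply: eq_map.
Qed.

Section FlagBasics.
Variables (F : fieldType) (n d : nat).
Implicit Types (U W V : flag F n d) (g h A : 'M[F]_d) (a b : 'I_n.+1).

Lemma flag0 U : U ord0 = 0%VS.
Proof. by case/and3P: (flagP U) => /eqP. Qed.

Lemma flagT U : U ord_max = fullv.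
Proof. by case/and3P: (flagP U) => _ /eqP. Qed.

Lemma flagS U a b : (a <= b)%N -> (U a <= U b)%VS.
Proof. by case/and3P: (flagP U) => _ _ /'forall_'forall_implyP; exact. Qed.

Lemma flag_eq U W : (forall a, U a = W a) -> U = W.
Proof. by move=> UW; apply/val_inj/ffunP. Qed.

Lemma rowspan_pid g p :
  rowspan (pid_mx p *m g : 'M_d) = <<[seq row i g | i : 'I_d <- enum 'I_d & (i < p)%N]>>%VS.
Proof.
have rowE i : row i (pid_mx p *m g : 'M_d) = if (i < p)%N then row i g else 0.
  rewrite row_mul; case: ltnP => ip.
    suff -> : row i (pid_mx p : 'M[F]_d) = delta_mx 0 i by rewrite -rowE.
    by apply/rowP => j; rewrite !mxE ip andbT eqxx eq_sym.
  suff -> : row i (pid_mx p : 'M[F]_d) = 0 by rewrite mul0mx.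
  by apply/rowP => j; rewrite !mxE ltnNge ip andbF.
apply/eqP; rewrite eqEsubv; apply/andP; split; apply/span_subvP => v.
  case/mapP => i _ ->; rewrite rowE; case: ifP => ip; last exact: mem0v.
  by apply/memv_span/map_f; rewrite mem_filter ip mem_enum.
case/mapP => i; rewrite mem_filter => /andP[ip _] ->.
by rewrite mem_rowspan -[row i g](_ : row i (pid_mx p *m g : 'M_d) = _) ?row_sub ?rowE ?ip.
Qed.

Lemma adaptedP g U : adapted g U <->
  g \in unitmx /\ forall a, U a = rowspan (pid_mx (\dim (U a)) *m g : 'M_d).
Proof. by split=> -[gu Ug]; split=> // a; rewrite {1}Ug rowspan_pid. Qed.

(** Concatenate bases of complements of each space of the flag in the next one;
    the rows of the frame are the vectors of the resulting basis. *)
Lemma adapted_exists U : exists g, adapted g U.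
Proof.
pose V i : {vspace 'rV[F]_d} := U (inord i).
pose X m : seq 'rV[F]_d := flatten [seq vbasis (V i.+1 :\: V i)%VS : seq _ | i <- iota 0 m].
have XS m : X m.+1 = X m ++ vbasis (V m.+1 :\: V m)%VS.
  have iotaS : iota 0 m.+1 = rcons (iota 0 m) m by rewrite -cats1 -addn1 iotaD.
  by rewrite /X iotaS -cats1 map_cat flatten_cat /= cats0.
have bX m : (m <= n)%N -> basis_of (V m) (X m).
  elim: m => [|m IHm] mn.
    by rewrite /X /= /V (_ : inord 0 = ord0) ?flag0 ?nil_basis //;
      apply: val_inj; rewrite /= inordK.
  have VS : (V m <= V m.+1)%VS by apply: flagS; rewrite !inordK // ltnW.
  have -> : V m.+1 = (V m + (V m.+1 :\: V m))%VS.
    by rewrite addvC addv_diff; apply/esym/addv_idPl.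
  rewrite XS; apply: cat_basis; rewrite ?vbasisP ?IHm ?(ltnW mn) //.
  by apply/directv_addP; rewrite capvC capv_diff.
have take_X k m : (m <= k)%N -> exists s, X k = X m ++ s.
  elim: k => [|k IHk]; first by rewrite leqn0 => /eqP->; exists [::]; rewrite cats0.
  rewrite leq_eqVlt => /predU1P[->|/IHk[s E]]; first by exists [::]; rewrite cats0.
  by exists (s ++ vbasis (V k.+1 :\: V k)%VS); rewrite XS E catA.
have UX a : U a = <<X a>>%VS.
  have := bX a (ltn_ord a); rewrite /V inord_val => /andP[/eqP-> _] //.
have sX a : size (X a) = \dim (U a).
  have := bX a (ltn_ord a); rewrite /V inord_val => b.
  by rewrite -(size_basis (X := in_tuple (X a)) b).
have sXn : size (X n) = d by rewrite (sX ord_max) flagT dimvf /dim /= mul1n.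
pose g : 'M[F]_d := \matrix_i (X n)`_i.
have rowg p : [seq row i g | i : 'I_d <- enum 'I_d & (i < p)%N] = take p (X n).
  rewrite (takeEfilter 0) sXn.
  by rewrite -val_enum_ord filter_map -map_comp; apply: eq_map => i; rewrite rowK.
exists g; split; last first.
  move=> a; rewrite rowg {1}UX; congr <<_>>%VS.
  by have [s ->] := take_X n a (ltn_ord a); rewrite -sX take_size_cat.
rewrite -row_full_unit -sub1mx; apply/row_subP => i.
have -> : g = pid_mx d *m g :> 'M_d by rewrite pid_mx_1 mul1mx.
rewrite -mem_rowspan rowspan_pid rowg take_oversize ?sXn //.
by rewrite -(UX ord_max) flagT memvf.
Qed.

End FlagBasics.

(** * Closed sets of pairs of flags *)

Section Semicontinuity.
Variables (F : fieldType) (n d : nat).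
Implicit Types (U W V : flag F n d) (g h A : 'M[F]_d) (a b : 'I_n.+1).

(** Since dim (U_a cap W_b) = dim U_a + dim W_b - dim (U_a + W_b), a lower bound
    on the intersection bounds the rank of the matrix that stacks the first rows
    of the two frames. *)
Lemma closed_dim_cap a b r :
  closed [set UW : flag2 F n d | (r <= \dim (UW.1 a :&: UW.2 b))%N].
Proof.
apply/flag2_closedE => p q.
pose G : 'M[mpoly.mpoly (d * d + d * d) F]_d :=
  \matrix_(i, j) mpoly.mpolyX F (mpoly.mnm1 (lshift _ (mxvec_index i j))).
pose H : 'M[mpoly.mpoly (d * d + d * d) F]_d :=
  \matrix_(i, j) mpoly.mpolyX F (mpoly.mnm1 (rshift _ (mxvec_index i j))).
pose B := col_mx (pid_mx (p a) *m G : 'M_d) (pid_mx (q b) *m H : 'M_d).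
pose C s := [set x | \rank (map_mx (fun f => polyval f x) B) <= s]%N.
exists (if (r <= p a + q b)%N then C (p a + q b - r)%N else set0).
  by case: ifP => _; [exact: affine_closed_rank | exact: affine_closed0].
move=> U W g h Up Wq /adaptedP[_ Ug] /adaptedP[_ Wh] /=.
have := dimv_sum_cap (U a) (W b); rewrite Up Wq => dimUW.
have [rpq|] := leqP r (p a + q b); last by move=> ?; split=> [|[]]; lia.
suff -> : C (p a + q b - r)%N (coords g h) = (\dim (U a + W b) <= p a + q b - r)%N :> Prop.
  by split; lia.
rewrite /C /= Ug Wh Up Wq -rowspan_col dim_rowspan /B; congr (is_true (\rank _ <= _)%N).
rewrite /polyval map_col_mx !map_mxM !map_pid_mx /=.
by congr col_mx; congr mulmx; apply/matrixP => i j; 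
  rewrite !mxE mpoly.mevalXU /coords ?row_mxEl ?row_mxEr mxvecE.
Qed.

End Semicontinuity.

Section Action.
Variables (F : fieldType) (n d : nat).
Implicit Types (U W V : flag F n d) (g h A : 'M[F]_d) (a b : 'I_n.+1).

Definition lact A : 'End('rV[F]_d) := linfun (mulmxr A).

Lemma lactE A v : lact A v = v *m A. Proof. by rewrite lfunE. Qed.

Lemma lact_ker0 A : A \in unitmx -> lker (lact A) == 0%VS.
Proof. by move=> uA; apply/lker0P => u v; rewrite !lactE => /(can_inj (mulmxK uA)). Qed.

Definition act_space U A : {ffun 'I_n.+1 -> {vspace 'rV[F]_d}} :=
  [ffun a => (lact A @: U a)%VS].

Fact flag_act_subproof U A (s := act_space U A) : A \in unitmx ->
  [&& s ord0 == 0%VS, s ord_max == fullv &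
    [forall a : 'I_n.+1, forall b : 'I_n.+1, (a <= b)%N ==> (s a <= s b)%VS]].
Proof.
move=> uA; rewrite !ffunE flag0 limg0 flagT lker0_limgf ?lact_ker0 ?eqxx //=.
by apply/'forall_'forall_implyP => a b ab; rewrite !ffunE limgS ?flagS.
Qed.

Definition flag_act U A (uA : A \in unitmx) : flag F n d := Flag (flag_act_subproof U uA).

Lemma flag_actE U A (uA : A \in unitmx) a : flag_act U uA a = (lact A @: U a)%VS.
Proof. by rewrite /= ffunE. Qed.

Lemma dim_flag_act U A (uA : A \in unitmx) a : \dim (flag_act U uA a) = \dim (U a).
Proof. by rewrite flag_actE limg_dim_eq // (eqP (lact_ker0 uA)) capv0. Qed.

Lemma dim_cap_flag_act U W A (uA : A \in unitmx) a b :
  \dim (flag_act U uA a :&: flag_act W uA b) = \dim (U a :&: W b).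
Proof.
by rewrite !flag_actE -lker0_img_cap ?lact_ker0 // limg_dim_eq // (eqP (lact_ker0 uA)) capv0.
Qed.

Lemma orb_act M U W A (uA : A \in unitmx) :
  orb M (U, W) -> orb M (flag_act U uA, flag_act W uA).
Proof. by move=> MUW a b; rewrite dim_cap_flag_act; exact: MUW. Qed.

Lemma adapted_act g U A (uA : A \in unitmx) :
  adapted g U -> adapted (g *m A) (flag_act U uA).
Proof.
move=> [gu Ug]; split=> [|a]; first by rewrite unitmx_mul gu.
rewrite dim_flag_act flag_actE {1}Ug limg_span -map_comp; congr <<_>>%VS.
by apply: eq_map => i /=; rewrite lactE row_mul.
Qed.

Lemma adapted_inj g U W :
  adapted g U -> adapted g W -> (forall a, \dim (U a) = \dim (W a)) -> U = W.
Proof. by move=> [_ Ug] [_ Wg] UW; apply: flag_eq => a; rewrite Ug Wg UW. Qed.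

Lemma orb_dim1 M U W a : orb M (U, W) ->
  \dim (U a) = (\sum_(i < n | i < a) \sum_(j < n) M i j)%N.
Proof.
move=> /(_ a ord_max) /=; rewrite flagT capvf => ->.
by apply: eq_bigr => i _; apply: eq_bigl => j; rewrite ltn_ord.
Qed.

Lemma orb_dim2 M U W b : orb M (U, W) ->
  \dim (W b) = (\sum_(i < n) \sum_(j < n | j < b) M i j)%N.
Proof.
move=> /(_ ord_max b) /=; rewrite flagT capfv => ->.
by apply: eq_bigl => i; rewrite ltn_ord.
Qed.

(** On frames, passing from W to a flag U in relative position [D] is left
    multiplication of the frame by a matrix that depends on the relative
    position only, by homogeneity.  So the condition says that the coordinates
    lie in an intersection of linear preimages of one closed set. *)
Lemma closed_fiber D (Z : set (flag2 F n d)) : closed Z ->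
  closed [set WV : flag2 F n d | forall U, orb D (U, WV.1) -> Z (U, WV.2)].
Proof.
move=> /flag2_closedE cZ; apply/flag2_closedE => p q.
have [pD|pD] := pselect (forall b : 'I_n.+1,
    p b = (\sum_(i < n) \sum_(j < n | j < b) D i j)%N); last first.
  exists setT; first exact: affine_closedT.
  move=> W V g h Wp _ _ _; split=> //= _ U UW; case: pD => b.
  by rewrite -Wp (orb_dim2 _ UW).
pose p' (a : 'I_n.+1) := (\sum_(i < n | i < a) \sum_(j < n) D i j)%N.
have [C cC ZC] := cZ p' q.
(* The frame changes that lead from W to a flag in relative position D. *)
pose P := [set A | forall W g, (forall a, \dim (W a) = p a) -> adapted g W ->
  exists2 U, orb D (U, W) & adapted (A *m g) U].
pose B A : 'M[F]_(d * d + d * d) := block_mx (lin_mx (mulmx A)) 0 0 1%:M.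
exists [set x | forall A, P A -> C (x *m B A)].
  pose Cf A := if `[< P A >] then [set x | C (x *m B A)] else setT.
  have -> : [set x | forall A, P A -> C (x *m B A)] = \bigcap_A Cf A.
    apply/seteqP; split=> x /= Cx A; first by move=> _; rewrite /Cf; case: asboolP => //; exact: Cx.
    by move=> PA; have := Cx A I; rewrite /Cf; case: asboolP.
  apply: affine_closed_bigI => A; rewrite /Cf; case: ifP => _.
    exact: affine_closed_preim.
  exact: affine_closedT.
have BE A g h : coords g h *m B A = coords (A *m g) h.
  by rewrite /coords mul_row_block mul_vec_lin mulmx0 mulmx0 mulmx1 addr0 add0r.
move=> W V g h Wp Vq gW hV /=; split=> [ZW A PA|CA U UW].
  have [U UW gU] := PA W g Wp gW.
  rewrite BE; apply/(ZC U V (A *m g) h _ Vq gU hV); last exact: ZW.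
  by move=> a; exact: orb_dim1 UW.
have [gu _] := gW; have [g' g'U] := adapted_exists U.
have Up a : \dim (U a) = p' a by exact: orb_dim1 UW.
apply/(ZC U V g' h Up Vq g'U hV).
rewrite -(mulmxKV gu g') -BE; apply: CA => W2 g2 W2p g2W2.
have [g2u _] := g2W2.
have xu : invmx g *m g2 \in unitmx by rewrite unitmx_mul unitmx_inv gu.
exists (flag_act U xu); last by rewrite -mulmxA; exact: adapted_act.
suff -> : W2 = flag_act W xu by exact: orb_act.
apply: (adapted_inj (g := g2)) => // [|a]; last by rewrite dim_flag_act Wp.
by rewrite -[g2 in adapted g2](mulKVmx gu); exact: adapted_act.
Qed.

Lemma convP D N U V :
  conv D N (U, V) <-> exists2 W, orb D (U, W) & orb N (W, V).
Proof.
split=> [[[[U' W] V'] [/= DUW NWV] [<- <-]]|[W DUW NWV]]; first by exists W.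
by exists (U, W, V).
Qed.

(** The set of (W, V) such that (U, V) lies in the closure of the convolution for
    every U in position [D] to W is closed by [closed_fiber], and it contains the
    orbit of [N]. *)
Lemma closure_conv D N (W V : flag F n d) U :
  orb D (U, W) -> closure (orb N) (W, V) -> closure (conv D N) (U, V).
Proof.
move=> UW; rewrite closureE => WV.
pose Y : set (flag2 F n d) :=
  [set WV | forall U, orb D (U, WV.1) -> closure (conv D N) (U, WV.2)].
suff YWV : Y (W, V) by exact: YWV.
apply: WV; split; first by apply: closed_fiber; exact: closed_closure.
move=> -[W' V'] W'V' U' U'W'.
by apply/subset_closure/convP; exists W'.
Qed.

End Action.

Section Curve.
Variables (F : fieldType) (n d : nat).
Hypothesis Finf : infinite_field F.
Implicit Types (U W V : flag F n d) (g h A : 'M[F]_d) (a b : 'I_n.+1).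

Lemma transvection_unit (X : 'M[F]_d) t : X *m X = 0 -> 1%:M + t *: X \in unitmx.
Proof.
move=> XX; suff /mulmx1_unit[] : (1%:M + t *: X) *m (1%:M - t *: X) = 1%:M by [].
rewrite mulmxDl mul1mx mulmxDr mulmx1 mulmxN -scalemxAl -scalemxAr XX !scaler0 subr0.
by rewrite subrK.
Qed.

(** The curve U (1 + tX) has frames depending affinely on [t], so a closed
    condition that holds for all nonzero [t] persists at [t = 0]. *)
Lemma closure_curve (S : set (flag2 F n d)) (X : 'M[F]_d) (XX : X *m X = 0) U V :
  (forall t, t != 0 -> S (flag_act U (transvection_unit t XX), V)) ->
  closure S (U, V).
Proof.
move=> St; rewrite closureE => Z [/flag2_closedE cZ SZ].
have [C cC ZC] := cZ (fun a => \dim (U a)) (fun b => \dim (V b)).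
have [g gU] := adapted_exists U; have [h hV] := adapted_exists V.
apply/(ZC U V g h) => //.
apply: (affine_closed_line (y := coords (g *m X) 0) Finf) => // t t0.
have -> : coords g h + t *: coords (g *m X) 0 = coords (g *m (1%:M + t *: X)) h.
  rewrite /coords scale_row_mx add_row_mx linear0 scaler0 addr0.
  by rewrite -linearZ -linearD /= mulmxDr mulmx1 scalemxAr.
apply/(ZC (flag_act U (transvection_unit t XX)) V) => //.
- by move=> a; rewrite dim_flag_act.
- exact: adapted_act.
- exact/SZ/St.
Qed.

End Curve.

(** * Orbits and the product of orbits *)

Section Ranks.
Variable n : nat.
Implicit Types (M N : 'M[nat]_n) (i j k : 'I_n) (a b : nat).

(** The prescribed dimension of the intersection of the [a]-th space of the first
    flag with the [b]-th space of the second on the orbit of [M]. *)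
Definition rk M a b : nat := (\sum_(i < n | i < a) \sum_(j < n | j < b) M i j)%N.

Lemma sum_ltS (f : 'I_n -> nat) i :
  (\sum_(k < n | k < i.+1) f k = f i + \sum_(k < n | k < i) f k)%N.
Proof.
rewrite (bigD1 i) //=; congr (_ + _)%N; apply: eq_bigl => k.
by rewrite ltnS ltn_neqAle andbC.
Qed.

Lemma rkS M i b : rk M i.+1 b = (\sum_(j < n | j < b) M i j + rk M i b)%N.
Proof. exact: sum_ltS. Qed.

Lemma rkD M N a b : rk (M + N) a b = (rk M a b + rk N a b)%N.
Proof.
rewrite /rk -big_split; apply: eq_bigr => i _; rewrite -big_split.
by apply: eq_bigr => j _; rewrite mxE.
Qed.

Lemma rk_delta k j a b : rk (delta_mx k j) a b = ((k < a) && (j < b))%N.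
Proof.
have sum1 (P : pred 'I_n) x : (\sum_(y | P y) (y == x) = P x)%N.
  rewrite big_mkcond (bigD1 x) //= eqxx big1 => [|y /negPf->]; last by case: ifP.
  by case: (P x).
rewrite /rk [LHS](eq_bigr (fun i => (i == k) * (j < b))%N) => [|i _].
  by rewrite -big_distrl /= (sum1 (fun i => i < a)%N) mulnb.
rewrite -(sum1 (fun j => j < b)%N) big_distrr; apply: eq_bigr => l _ /=.
by rewrite mxE -mulnb natn.
Qed.

(** Each entry is a second difference of [rk]. *)
Lemma rk_inj M N : (forall a b : 'I_n.+1, rk M a b = rk N a b) -> M = N.
Proof.
move=> MN; apply/matrixP => i j.
have e a b : (a <= n)%N -> (b <= n)%N -> rk M a b = rk N a b.
  by move=> an bn; have := MN (inord a) (inord b); rewrite !inordK.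
have sq K : (rk K i.+1 j.+1 + rk K i j = K i j + rk K i j.+1 + rk K i.+1 j)%N.
  rewrite !rkS sum_ltS; lia.
have := sq M; have := sq N; rewrite !e ?ltn_ord ?(ltnW (ltn_ord _)) //.
lia.
Qed.

End Ranks.

Section Orbits.
Variables (F : fieldType) (n d : nat).
Implicit Types (U W V : flag F n d) (M N D : 'M[nat]_n).

Lemma orb_disjoint M N (x : flag2 F n d) : orb M x -> orb N x -> M = N.
Proof. by move=> Mx Nx; apply: rk_inj => a b; rewrite /rk -Mx -Nx. Qed.

Lemma closure_dim_cap M (x : flag2 F n d) (a b : 'I_n.+1) :
  closure (orb M) x -> (rk M a b <= \dim (x.1 a :&: x.2 b))%N.
Proof.
rewrite closureE => cx.
pose Z := [set UW : flag2 F n d | rk M a b <= \dim (UW.1 a :&: UW.2 b)]%N.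
suff : Z x by [].
apply: cx; split; first exact: closed_dim_cap.
by move=> y My; rewrite /Z /mkset (My a b).
Qed.

Lemma closure_orb_rk M N (x : flag2 F n d) (a b : 'I_n.+1) :
  closure (orb M) x -> orb N x -> (rk M a b <= rk N a b)%N.
Proof. by move=> /(closure_dim_cap a b) + Nx; rewrite (Nx a b). Qed.

Definition coordspan (Q : pred 'I_d) : {vspace 'rV[F]_d} :=
  <<[seq delta_mx 0%R x | x : 'I_d <- enum 'I_d & Q x]>>%VS.

Lemma mem_coordspan (Q : pred 'I_d) v :
  (v \in coordspan Q) = [forall x, ~~ Q x ==> (v 0 x == 0)].
Proof.
apply/idP/forallP => [vQ x|v0].
  apply/implyP => Qx.
  pose K : {vspace 'rV[F]_d} := lker (linfun (mulmxr (delta_mx x 0 : 'M[F]_(d, 1)))).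
  suff /subvP/(_ v vQ) : (coordspan Q <= K)%VS.
    by rewrite memv_ker lfunE /= -colE => /eqP/matrixP/(_ 0 0); rewrite !mxE => ->.
  apply/span_subvP => _ /mapP[y + ->]; rewrite mem_filter => /andP[Qy _].
  rewrite memv_ker lfunE /= mul_delta_mx_0 //.
  by apply: contraNneq Qx => <-.
rewrite [v]row_sum_delta; apply: memv_suml => x _.
have := v0 x; case: (boolP (Q x)) => [Qx _|_ /eqP->]; last by rewrite scale0r mem0v.
by apply/memvZ/memv_span/map_f; rewrite mem_filter Qx mem_enum.
Qed.

(** Unit vectors indexed by a subset form a part of a basis. *)
Lemma dim_coordspan (Q : pred 'I_d) : \dim (coordspan Q) = #|Q|.
Proof.
pose e (x : 'I_d) : 'rV[F]_d := delta_mx 0 x.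
have fe : free [seq e x | x : 'I_d].
  apply: (basis_free (U := fullv)); rewrite basisEdim size_image card_ord.
  rewrite dimvf /dim /= mul1n leqnn andbT; apply/subvP => v _.
  rewrite [v]row_sum_delta; apply: memv_suml => x _.
  by apply/memvZ/memv_span/map_f; rewrite mem_enum.
have : free [seq e x | x : 'I_d <- enum 'I_d & Q x].
  move: fe; rewrite -(perm_free (X := [seq e x |
      x <- seq.filter Q (enum 'I_d) ++ seq.filter (predC Q) (enum 'I_d)])).
    by rewrite map_cat => /catl_free.
  by apply: perm_map; rewrite perm_filterC.
rewrite /free => /eqP ->; rewrite size_map cardE. congr size; rewrite enumT; exact: eq_filter.
Qed.

(** Label the [d] coordinates by matrix positions, with position (i, j) used
    [M i j] times, and take the coordinate flags that filter them by row and by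
    column. *)
Lemma orb_nonempty M : M \in Mset n d -> exists x : flag2 F n d, orb M x.
Proof.
rewrite inE => /eqP sM.
pose T := ('I_n * 'I_n)%type.
pose s : seq T := flatten [seq nseq (M p.1 p.2) p | p : T].
have count_s (P : pred T) : count P s = (\sum_(p | P p) M p.1 p.2)%N.
  rewrite count_flatten -map_comp sumnE big_map big_enum /= [RHS]big_mkcond.
  by apply: eq_bigr => p _; rewrite count_nseq; case: (P p); rewrite ?mul1n.
have sz : size s == d.
  by rewrite -count_predT count_s -sM pair_big.
pose f (x : 'I_d) : T := tnth (Tuple sz) x.
have card_f (P : pred T) : #|[pred x | P (f x)]| = (\sum_(p | P p) M p.1 p.2)%N.
  rewrite -count_s cardE size_filter -(count_map f P) -enumT.
  by congr count; rewrite /f map_tnth_enum.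
pose row_flag (g : T -> 'I_n) : {ffun 'I_n.+1 -> {vspace 'rV[F]_d}} :=
  [ffun a : 'I_n.+1 => coordspan (fun x => (g (f x) < a)%N)].
have flagP g : [&& row_flag g ord0 == 0%VS, row_flag g ord_max == fullv &
    [forall a : 'I_n.+1, forall b : 'I_n.+1,
      (a <= b)%N ==> (row_flag g a <= row_flag g b)%VS]].
  rewrite !ffunE; apply/and3P; split.
  - by rewrite -dimv_eq0 dim_coordspan; apply/eqP/eq_card0 => x; rewrite inE.
  - apply/eqP/vspaceP => v; rewrite memvf mem_coordspan.
    by apply/forallP => x; rewrite ltn_ord.
  - apply/'forall_'forall_implyP => a b ab; rewrite !ffunE; apply/subvP => v.
    rewrite !mem_coordspan => /'forall_implyP v0; apply/'forall_implyP => x.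
    by rewrite -leqNgt => bx; apply: v0; rewrite -leqNgt (leq_trans ab).
exists (Flag (flagP fst), Flag (flagP snd)) => a b /=; rewrite !ffunE.
have -> : (coordspan (fun x => (f x).1 < a)%N :&: coordspan (fun x => (f x).2 < b)%N)%VS =
    coordspan (fun x => ((f x).1 < a)%N && ((f x).2 < b)%N).
  apply/vspaceP => v; rewrite memv_cap !mem_coordspan.
  apply/andP/'forall_implyP => [[/'forall_implyP u /'forall_implyP w] x|u].
    by rewrite negb_and => /orP[/u|/w].
  by split; apply/'forall_implyP => x ux; apply: u; rewrite negb_and ux ?orbT.
rewrite dim_coordspan (card_f (fun p => (p.1 < a)%N && (p.2 < b)%N)) pair_big //.
Qed.

(** By semicontinuity the orbit of [M] is the part of the convolution where no
    intersection is larger than on that orbit, so it is open there.  Any open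
    orbit meets the dense orbit of [M] and hence equals it. *)
Lemma circ_eq D N M : M \in Mset n d -> col_sums D = row_sums N ->
  (orb M : set (flag2 F n d)) `<=` conv D N ->
  (conv D N : set (flag2 F n d)) `<=` closure (orb M) ->
  circ F d D N = M.
Proof.
move=> dM DN MD DM; rewrite /circ DN eqxx.
have Mopen : open_orbit_in (conv D N : set (flag2 F n d)) M.
  split=> //; exists (~` \bigcup_(ab in [set: 'I_n.+1 * 'I_n.+1])
    [set UW : flag2 F n d | (rk M ab.1 ab.2 < \dim (UW.1 ab.1 :&: UW.2 ab.2))%N]).
    rewrite openC; apply: closed_bigcup => [|ab _]; first exact: finite_finset.
    exact: closed_dim_cap.
  apply/seteqP; split=> [x Mx|x [DNx /= Mx] a b].
    split; first exact: MD.
    by move=> [[a b] _] /=; rewrite (Mx a b) ltnn.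
  have xM := closure_dim_cap a b (DM _ DNx).
  apply/eqP; rewrite eqn_leq xM andbT leqNgt; apply/negP => lt.
  by apply: Mx; exists (a, b).
have uniqM K : open_orbit_in (conv D N : set (flag2 F n d)) K -> K = M.
  move=> [dK KDN [A oA KA]]; have [x Kx] := orb_nonempty dK.
  have [DNx Ax] : (conv D N `&` A) x by rewrite -KA.
  have [y [My Ay]] := DM x DNx A (open_nbhs_nbhs (conj oA Ax)).
  by apply: (orb_disjoint (x := y)) => //; rewrite KA; split=> //; exact: MD.
by apply: xget_unique => [|K [/uniqM]].
Qed.

End Orbits.

(** * Hyperplanes and transvections *)

Section LinearAlgebra.
Variables (F : fieldType) (vT : vectType F).
Implicit Types (S U V W : {vspace vT}) (x y u : vT).

Lemma dimv_addl_line W x : x \notin W -> \dim (W + <[x]>) = (\dim W).+1.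
Proof.
move=> xW; rewrite dimv_disjoint_sum ?dim_vline.
  by case: eqVneq xW => [->|_]; rewrite ?mem0v // addn1.
apply/eqP; rewrite -subv0; apply/subvP => v; rewrite memv_cap memv0 => /andP[vW /vlineP[a va]].
case: (eqVneq a 0) va vW => [->|a0] ->; first by rewrite scale0r eqxx.
by move=> /(memvZ a^-1); rewrite scalerA mulVf // scale1r (negPf xW).
Qed.

Lemma hyperplane_line W U x : (W <= U)%VS -> \dim U = (\dim W).+1 ->
  x \in U -> x \notin W -> U = (W + <[x]>)%VS.
Proof.
move=> WU dU xU xW; apply/eqP; rewrite eq_sym eqEdim subv_add WU -memvE xU /=.
by rewrite dimv_addl_line // dU.
Qed.

(** Add to [S] a complement in [U] of the sum of [S] and the line through [x]. *)
Lemma hyperplane_avoid S U x : (S <= U)%VS -> x \in U -> x \notin S ->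
  exists H : {vspace vT}, [/\ (S <= H)%VS, (H <= U)%VS, x \notin H & \dim U = (\dim H).+1].
Proof.
move=> SU xU xS; pose T := (S + <[x]>)%VS.
have TU : (T <= U)%VS by rewrite subv_add SU -memvE.
have UE : (S + (U :\: T) + <[x]> = U)%VS.
  by rewrite -addvA (addvC (U :\: T)%VS) addvA -/T addvC addv_diff; exact/addv_idPl.
have dS := dimv_addl_line xS; rewrite -/T in dS.
have dUT : (\dim (U :\: T) + \dim T = \dim U)%N.
  have := dimv_cap_compl U T; rewrite (capv_idPr TU); lia.
have dH : (\dim (S + (U :\: T))%VS <= \dim S + \dim (U :\: T))%N.
  by have := dimv_sum_cap S (U :\: T)%VS; lia.
have xH : x \notin (S + (U :\: T))%VS.
  apply/negP => xH; move: UE; have /addv_idPl -> : (<[x]> <= S + (U :\: T))%VS by rewrite -memvE.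
  by move=> UE; move: dH; rewrite UE; lia.
exists (S + (U :\: T))%VS; split=> //; first exact: addvSl.
  by rewrite subv_add SU diffvSl.
by rewrite -{1}UE dimv_addl_line.
Qed.

(** If [U] is not inside W + V, then U cap V lies in [W]: a vector of U cap V
    outside [W] would span [U] together with [W]. *)
Lemma dim_cap_hyperplane W U V : (W <= U)%VS -> \dim U = (\dim W).+1 ->
  \dim (U :&: V) = (\dim (W :&: V) + (U <= W + V)%VS)%N.
Proof.
move=> WU dU; have := dimv_sum_cap U V; have := dimv_sum_cap W V.
case: (boolP (U <= W + V)%VS) => [UWV|nUWV].
  suff -> : (U + V = W + V)%VS by lia.
  apply/eqP; rewrite eqEsubv subv_add UWV addvSr /=.
  by rewrite addvS.
move=> _ _; rewrite addn0; suff -> : (U :&: V = W :&: V)%VS by [].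
apply/eqP; rewrite eqEsubv (capvS WU) // andbT subv_cap capvSr andbT.
apply/subvP => z; rewrite memv_cap => /andP[zU zV]; apply: contraNT nUWV => zW.
by rewrite (hyperplane_line WU dU zU zW) addvS // -memvE.
Qed.

End LinearAlgebra.

(** Take X = phi (x) y for a linear form phi that is 1 at [u] and vanishes on
    [S]; it squares to zero because [y] lies in [S]. *)
Lemma transvection_exists (F : fieldType) d (S : {vspace 'rV[F]_d}) u y :
  u \notin S -> y \in S ->
  exists X : 'M[F]_d, [/\ X *m X = 0, forall v, v \in S -> v *m X = 0, u *m X = y &
    forall v, v *m X \in <[y]>%VS].
Proof.
move=> uS yS; pose f : 'End('rV[F]_d) := (\1 - projv S)%VF.
have fE v : f v = v - projv S v by rewrite add_lfunE opp_lfunE id_lfunE.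
have [i fui] : exists i, f u 0 i != 0.
  apply/existsP; apply: contraNT uS; rewrite negb_exists => /forallP f0.
  suff /eqP : f u = 0 by rewrite fE subr_eq0 => /eqP ->; exact: memv_proj.
  by apply/rowP => i; rewrite mxE; apply/eqP/negbNE/f0.
pose X : 'M[F]_d := (f u 0 i)^-1 *: (lin1_mx f *m delta_mx i 0 *m y).
have XE v : v *m X = ((f u 0 i)^-1 * f v 0 i) *: y.
  rewrite -scalemxAr !mulmxA mul_rV_lin1 -scalerA; congr (_ *: _).
  by rewrite -colE [col i _]mx11_scalar mul_scalar_mx mxE.
have X0 v : v \in S -> v *m X = 0.
  by move=> vS; rewrite XE (fE v) projv_id // subrr mxE mulr0 scale0r.
exists X; split=> // [||v].
- apply/row_matrixP => k; rewrite row_mul row0 X0 // rowE XE; exact: memvZ.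
- by rewrite XE mulVf // scale1r.
- by rewrite XE memvZ // memv_line.
Qed.

(** * Stages of a flag *)

Section Stages.
Variables (F : fieldType) (n d : nat).
Implicit Types (U W V : flag F n d) (M N D : 'M[nat]_n).

(** Spaces of a flag indexed by natural numbers, so that neighbouring stages can
    be named by arithmetic. *)
Definition stage U (a : nat) : {vspace 'rV[F]_d} := U (inord a).

Lemma stageS U a b : (a <= b)%N -> (b <= n)%N -> (stage U a <= stage U b)%VS.
Proof. by move=> ab bn; apply: flagS; rewrite !inordK // ltnS (leq_trans ab). Qed.

Lemma stageT U : stage U n = fullv.
Proof. by rewrite /stage (_ : inord n = ord_max) ?flagT //; apply: val_inj; rewrite /= inordK. Qed.

Lemma flag_eq_stage U W : (forall a, (a <= n)%N -> stage U a = stage W a) -> U = W.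
Proof.
by move=> UW; apply: flag_eq => a; have := UW a (ltn_ord a); rewrite /stage inord_val.
Qed.

Lemma orbP M U V : orb M (U, V) <-> forall a b, (a <= n)%N -> (b <= n)%N ->
  \dim (stage U a :&: stage V b) = rk M a b.
Proof.
split=> MUV a b; last by have := MUV a b (ltn_ord a) (ltn_ord b); rewrite /stage !inord_val.
by move=> an bn; rewrite /stage (MUV (inord a) (inord b)) !inordK.
Qed.

Lemma orb_stage_dim1 M U V a : orb M (U, V) -> (a <= n)%N -> \dim (stage U a) = rk M a n.
Proof. by move=> /orbP MUV an; rewrite -MUV // stageT capvf. Qed.

Lemma orb_stage_dim2 M U V b : orb M (U, V) -> (b <= n)%N -> \dim (stage V b) = rk M n b.
Proof. by move=> /orbP MUV bn; rewrite -MUV // stageT capfv. Qed.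

Lemma flag_set U l (H : {vspace 'rV[F]_d}) : (0 < l < n)%N ->
  (stage U l.-1 <= H)%VS -> (H <= stage U l.+1)%VS ->
  exists W, stage W l = H /\ forall a, (a <= n)%N -> a != l -> stage W a = stage U a.
Proof.
move=> /andP[l0 ln] lH Hl.
pose s : {ffun 'I_n.+1 -> {vspace 'rV[F]_d}} :=
  [ffun a : 'I_n.+1 => if a == l :> nat then H else U a].
have Us (a : 'I_n.+1) : U a = stage U a by rewrite /stage inord_val.
have sP : [&& s ord0 == 0%VS, s ord_max == fullv &
    [forall a : 'I_n.+1, forall b : 'I_n.+1, (a <= b)%N ==> (s a <= s b)%VS]].
  rewrite !ffunE /= (ltn_eqF l0) (gtn_eqF ln) flag0 flagT !eqxx /=.
  apply/'forall_'forall_implyP => a b ab; rewrite !ffunE !Us.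
  have [an bn] : (a <= n /\ b <= n)%N by have := ltn_ord a; have := ltn_ord b.
  case: eqP => al; case: eqP => bl //.
  - by apply: subv_trans Hl (stageS U _ bn); lia.
  - by apply: subv_trans (stageS U _ _) lH; lia.
  - exact: stageS.
exists (Flag sP); split=> [|a an al]; rewrite /stage /= ffunE inordK ?eqxx ?(ltnW ln) //.
  by rewrite ltnS ltnW.
by rewrite (negPf al).
Qed.

(** Stable stages are mapped onto themselves because dimensions are preserved. *)
Lemma flag_act_stable U A (uA : A \in unitmx) :
  (forall a v, (a <= n)%N -> v \in stage U a -> v *m A \in stage U a) -> flag_act U uA = U.
Proof.
move=> UA; apply: flag_eq_stage => a an; apply/eqP; rewrite eqEdim dim_flag_act leqnn andbT.
rewrite /stage flag_actE; apply/subvP => _ /memv_imgP[v vU ->]; rewrite lactE.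
exact: UA.
Qed.

Lemma mem_flag_act U A (uA : A \in unitmx) a v :
  v \in stage U a -> v *m A \in stage (flag_act U uA) a.
Proof. by move=> vU; rewrite /stage flag_actE -lactE; exact: memv_img. Qed.

(** Otherwise U_{i+1} cap V_{j+1} would be the sum of U_i cap V_{j+1} and
    U_{i+1} cap V_j, and counting dimensions would give [M i j = 0]. *)
Lemma orb_mem_gt0 M U V (i j : 'I_n) : orb M (U, V) -> (0 < M i j)%N ->
  exists x, [/\ x \in stage U i.+1, x \in stage V j.+1 & x \notin (stage U i + stage V j)%VS].
Proof.
move=> /orbP MUV Mij; have [iN jN] := (ltn_ord i, ltn_ord j).
suff /subvPn[x] : ~~ (stage U i.+1 :&: stage V j.+1 <= stage U i + stage V j)%VS.
  by rewrite memv_cap => /andP[xU xV] xn; exists x.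
apply: contraTN Mij => sub; rewrite -leqNgt.
have UU : (stage U i <= stage U i.+1)%VS by exact: stageS.
have VV : (stage V j <= stage V j.+1)%VS by exact: stageS.
have sub' : (stage U i.+1 :&: stage V j.+1 <=
    stage U i :&: stage V j.+1 + stage U i.+1 :&: stage V j)%VS.
  apply/subvP => x xUV; have /memv_addP[u uU [v vV xE]] := subvP sub x xUV.
  move: xUV; rewrite memv_cap xE => /andP[xU xV]; apply: memv_add; rewrite memv_cap.
    by rewrite uU -(addrK v u) memvB // (subvP VV).
  by rewrite vV andbT -(addKr u v) addrC memvB // (subvP UU).
have := dimv_sum_cap (stage U i :&: stage V j.+1) (stage U i.+1 :&: stage V j).
have := dimvS sub'.
have : (stage U i :&: stage V j <=
    (stage U i :&: stage V j.+1) :&: (stage U i.+1 :&: stage V j))%VS.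
  by rewrite !subv_cap capvSl capvSr (subv_trans (capvSr _ _) VV) (subv_trans (capvSl _ _) UU).
move/dimvS; rewrite !MUV ?(ltnW iN) ?(ltnW jN) // !rkS sum_ltS; lia.
Qed.

End Stages.

(** * The orbit of an almost diagonal matrix *)

Section Covers.
Variables (F : fieldType) (n d : nat).
Implicit Types (U W V : flag F n d) (M N D : 'M[nat]_n) (mu : 'rV[nat]_n).

Definition covers l U W :=
  [/\ forall a, (a <= n)%N -> a != l -> stage U a = stage W a,
      (stage W l <= stage U l)%VS & \dim (stage U l) = (\dim (stage W l)).+1].

Lemma orb_tr M U W : orb M^T (W, U) <-> orb M (U, W).
Proof.
have rkT K a b : rk K^T b a = rk K a b.
  rewrite /rk exchange_big; apply: eq_bigr => i _; apply: eq_bigr => j _.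
  by rewrite mxE.
by split=> /orbP MUW; apply/orbP => a b an bn; rewrite capvC MUW // -rkT ?trmxK.
Qed.

Lemma rk_diag mu a b : rk (diag_mx mu) a b = (\sum_(i < n | i < minn a b) mu 0%R i)%N.
Proof.
rewrite /rk [RHS](eq_bigl (fun i : 'I_n => (i < a) && (i < b))%N) => [|i]; last by rewrite leq_min.
rewrite big_mkcondr; apply: eq_bigr => i _; case: ifP => ib.
  rewrite (bigD1 i) //= mxE eqxx big1 ?addn0 // => j /andP[_ /negPf ji].
  by rewrite mxE eq_sym ji.
by rewrite big1 // => j jb; rewrite mxE; case: eqP => // ij; rewrite -ij ib in jb.
Qed.

Lemma rk_row_sums M a : rk M a n = (\sum_(i < n | i < a) row_sums M 0%R i)%N.
Proof.
apply: eq_bigr => i _; rewrite mxE; apply: eq_bigl => j; exact: ltn_ord.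
Qed.

Lemma sum_delta (l : 'I_n) b :
  (\sum_(i < n | i < b) (delta_mx 0%R l : 'rV[nat]_n) 0%R i = (l < b))%N.
Proof.
rewrite big_mkcond (bigD1 l) //= !mxE !eqxx big1 ?addn0 => [|i /negPf il]; first by case: ifP.
by rewrite mxE il andbF; case: ifP.
Qed.

Variables (k l : 'I_n).
Hypothesis kl : l = k.+1 :> nat.

(** The two dimension vectors differ only at stage [l], and the diagonal ranks
    say that the smaller of the two stages is contained in the larger one. *)
Lemma orb_coversP mu U W : orb (diag_mx mu + delta_mx k l) (U, W) <->
  covers l U W /\ forall b, (b <= n)%N ->
    \dim (stage W b) = (\sum_(i < n | i < b) mu 0%R i + (l < b))%N.
Proof.
have ln := ltn_ord l.
have rkE a b : rk (diag_mx mu + delta_mx k l) a b =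
    (\sum_(i < n | i < minn a b) mu 0%R i + ((k < a) && (l < b)))%N.
  by rewrite rkD rk_diag rk_delta.
split=> [DUW|[[UW WU dU] dW]].
  have dU a : (a <= n)%N -> \dim (stage U a) = (\sum_(i < n | i < a) mu 0%R i + (k < a))%N.
    by move=> an; rewrite (orb_stage_dim1 DUW an) rkE ln andbT (minn_idPl an).
  have dW b : (b <= n)%N -> \dim (stage W b) = (\sum_(i < n | i < b) mu 0%R i + (l < b))%N.
    by move=> bn; rewrite (orb_stage_dim2 DUW bn) rkE ltn_ord (minn_idPr bn).
  have dUW a : (a <= n)%N ->
      \dim (stage U a :&: stage W a) = (\sum_(i < n | i < a) mu 0%R i + (l < a))%N.
    move/orbP: DUW => DUW an; rewrite DUW // rkE minnn; congr (_ + _ : nat)%N.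
    by case: (ltnP l a) => [la|]; rewrite ?andbF //= (_ : k < a)%N // (ltn_trans _ la) // kl.
  have WU a : (a <= n)%N -> (stage W a <= stage U a)%VS.
    move=> an; apply/capv_idPr/eqP; rewrite eqEdim capvSr /=.
    by rewrite dUW // dW.
  split=> //; split=> [a an al||]; last 2 first.
  - by apply: WU; exact: ltnW.
  - by rewrite dU ?dW ?(ltnW ln) // ltnn kl leqnn addn0 addn1.
  apply/eqP; rewrite eq_sym eqEdim WU //= dU ?dW // leq_add2l.
  by move: al; rewrite kl; case: (ltngtP a k.+1) => //; lia.
apply/orbP => a b an bn; rewrite rkE.
have dUa : \dim (stage U a) = (\sum_(i < n | i < a) mu 0%R i + (k < a))%N.
  case: (eqVneq a l) => [->|al]; first by rewrite dU dW ?(ltnW ln) // ltnn kl leqnn addn0 addn1.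
  rewrite UW ?dW //; congr (_ + _ : nat)%N; move: al; rewrite kl; lia.
have [ab|ba] := ltnP a b.
  have -> : (stage U a :&: stage W b = stage U a)%VS.
    apply/capv_idPl; case: (eqVneq b l) => [bl|bl].
      by rewrite UW ?stageS ?(ltnW ab) // -bl; lia.
    by rewrite -UW // stageS // ltnW.
  rewrite dUa; congr (_ + _ : nat)%N; rewrite kl; lia.
have -> : (stage U a :&: stage W b = stage W b)%VS.
  apply/capv_idPr; apply: subv_trans (stageS U ba an).
  by case: (eqVneq b l) => [->|bl] //; rewrite UW.
rewrite dW //; congr (_ + _ : nat)%N; rewrite kl; lia.
Qed.

(** The row sums of [N] give the dimensions of the stages of [W], which is all
    that membership in the orbit requires beyond the covering relation. *)
Lemma covers_orb mu N U W V : row_sums N = mu + delta_mx 0 l -> orb N (W, V) ->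
  orb (diag_mx mu + delta_mx k l) (U, W) <-> covers l U W.
Proof.
move=> rN NWV; rewrite orb_coversP; split=> [[]//|UW]; split=> // b bn.
rewrite (orb_stage_dim1 NWV bn) rk_row_sums rN -sum_delta -big_split.
by apply: eq_bigr => i _; rewrite mxE.
Qed.

(** Transposing the almost diagonal matrix exchanges the two flags. *)
Lemma covers_orb_tr mu N U W V : row_sums N = mu + delta_mx 0 k -> orb N (W, V) ->
  orb (diag_mx mu + delta_mx l k) (U, W) <-> covers l W U.
Proof.
move=> rN NWV.
have -> : diag_mx mu + delta_mx l k = (diag_mx mu + delta_mx k l)^T.
  by rewrite linearD /= tr_diag_mx trmx_delta.
rewrite orb_tr orb_coversP; split=> [[]//|UW]; split=> // b bn.
have dW : \dim (stage W b) = (\sum_(i < n | i < b) mu 0%R i + (k < b))%N.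
  rewrite (orb_stage_dim1 NWV bn) rk_row_sums rN -sum_delta -big_split.
  by apply: eq_bigr => i _; rewrite mxE.
case: UW => UW _ dWl; case: (eqVneq b l) => [bl|bl].
  by move: dW; rewrite bl dWl ltnn kl leqnn addn1 addn0 => -[].
rewrite -UW // dW; congr (_ + _ : nat)%N; move: bl; rewrite kl; lia.
Qed.

End Covers.

(** * Moving one unit between adjacent rows *)

Section StepRanks.
Variable n : nat.
Implicit Types (M N : 'M[nat]_n) (mu : 'rV[nat]_n).

Lemma MsetE d M : (M \in Mset n d) = (rk M n n == d).
Proof.
rewrite inE /rk; congr (_ == _); apply: eq_big => i; rewrite ?ltn_ord // => _.
by apply: eq_bigl => j; rewrite ltn_ord.
Qed.

Lemma rk_exchange M N (k l j : 'I_n) a b : l = k.+1 :> nat ->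
  M + delta_mx l j = N + delta_mx k j ->
  rk M a b = (rk N a b + ((a == l :> nat) && (j < b)))%N.
Proof.
move=> kl /(congr1 (fun K => rk K a b)); rewrite !rkD !rk_delta kl.
by case: (ltnP j b) => _; rewrite ?andbF ?andbT ?addn0 //; lia.
Qed.

Lemma Mset_exchange d M N (k l j : 'I_n) : l = k.+1 :> nat ->
  M + delta_mx l j = N + delta_mx k j -> (M \in Mset n d) = (N \in Mset n d).
Proof.
by move=> kl /rk_exchange MN; rewrite !MsetE MN // (gtn_eqF (ltn_ord l)) addn0.
Qed.

Lemma col_sums_step mu (k l : 'I_n) : col_sums (diag_mx mu + delta_mx k l) = mu + delta_mx 0 l.
Proof.
apply/rowP => j; rewrite !mxE.
rewrite (eq_bigr (fun i : 'I_n => (i == j) * mu 0%R j + (i == k) * (j == l))%N).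
  rewrite big_split /= -!big_distrl /=; congr (_ + _ : nat)%N.
    by rewrite (bigD1 j) //= eqxx big1 ?addn0 ?mul1n // => i /negPf->.
  by rewrite (bigD1 k) //= eqxx big1 ?addn0 ?mul1n ?natn // => i /negPf->.
move=> i _; rewrite !mxE natn mulnb; congr (_ + _ : nat)%N.
by case: eqVneq => [->|]; rewrite ?mul1n.
Qed.

End StepRanks.

(** * Enlarging one stage *)

Section Steps.
Variables (F : fieldType) (n d : nat).
Implicit Types (U W V : flag F n d) (M N D : 'M[nat]_n) (mu : 'rV[nat]_n).
Variables (k l j : 'I_n).
Hypothesis kl : l = k.+1 :> nat.

Let ln : (l < n)%N. Proof. exact: ltn_ord. Qed.
Let lnW : (l <= n)%N. Proof. exact: ltnW. Qed.
Let kll : (k <= l)%N. Proof. by rewrite kl. Qed.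
Let kNl : k != l :> nat. Proof. by rewrite kl neq_ltn leqnn. Qed.

Section Raise.
Variables (M N : 'M[nat]_n).
Hypothesis MN : M + delta_mx l j = N + delta_mx k j.
Hypothesis Nlj : (0 < N l j)%N.
Hypothesis Nl0 : forall j' : 'I_n, (j < j')%N -> N l j' = 0%N.

(** By [dim_cap_hyperplane] only the columns at which U_l is contained in
    W_l + V_b matter. *)
Lemma raise_orb U W V : covers l U W -> orb N (W, V) ->
  (forall b, (b <= n)%N -> (stage U l <= stage W l + stage V b)%VS = (j < b)%N) ->
  orb M (U, V).
Proof.
move=> [UW WU dU] /orbP NWV UWV; apply/orbP => a b an bn.
rewrite (rk_exchange _ _ kl MN); case: (eqVneq a l) => [->|al]; last first.
  by rewrite addn0 UW // NWV.
by rewrite (dim_cap_hyperplane _ WU dU) NWV // UWV.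
Qed.

(** All nonzero entries of row [l] lie in columns below [b], so W_{l+1} gains nothing
    over W_l modulo V_b. *)
Lemma raise_sub W V b : orb N (W, V) -> (j < b)%N -> (b <= n)%N ->
  (stage W l.+1 <= stage W l + stage V b)%VS.
Proof.
move=> NWV jb bn; have dW a := orb_stage_dim1 (a := a) NWV; move/orbP: NWV => NWV.
have rowE : (\sum_(j' < n | j' < b) N l j' = \sum_(j' < n | j' < n) N l j')%N.
  rewrite big_mkcond [RHS]big_mkcond; apply: eq_bigr => j' _; rewrite ltn_ord.
  by case: ltnP => // bj'; rewrite Nl0 // (leq_trans jb).
suff /eqP -> : (stage W l + stage V b == stage W l.+1 + stage V b)%VS by exact: addvSl.
rewrite eqEdim addvS ?stageS //=.
have := dimv_sum_cap (stage W l) (stage V b); have := dimv_sum_cap (stage W l.+1) (stage V b).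
by rewrite !NWV // !dW // !rkS rowE; lia.
Qed.

(** As [M k j] is positive, U_l has a vector x in V_{j+1} that is not in
    U_k + V_j; the intermediate flag has as stage [l] a hyperplane of U_l that
    contains U_k and the intersection of U_l with V_j but avoids x. *)
Lemma raise_conv mu U V : row_sums N = mu + delta_mx 0 l -> orb M (U, V) ->
  conv (diag_mx mu + delta_mx k l) N (U, V).
Proof.
clear Nlj Nl0; move=> rN MUV.
have Mkj : (0 < M k j)%N.
  have := congr1 (fun K : 'M_n => K k j) MN; rewrite !mxE !eqxx (_ : (k == l) = false) //=.
    by rewrite !natn; lia.
  exact/negbTE.
have [x [xU xV xn]] := orb_mem_gt0 MUV Mkj; rewrite -kl in xU.
pose S := (stage U k + stage V j :&: stage U l)%VS.
have SE : S = ((stage U k + stage V j) :&: stage U l)%VS by rewrite /S vspace_modl ?stageS.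
have [|||H [SH HU xH dU]] := @hyperplane_avoid _ _ S (stage U l) x.
- by rewrite SE capvSr.
- by [].
- by rewrite SE memv_cap xU andbT.
have [|||W [WH WU]] := @flag_set _ _ _ U l H.
- by rewrite ln kl.
- by rewrite kl; apply: subv_trans SH; exact: addvSl.
- by apply: subv_trans HU _; exact: stageS.
have UW : covers l U W by split; rewrite ?WH // => a an al; rewrite WU.
have NWV : orb N (W, V).
  move: MUV => /orbP MUV; apply/orbP => a b an bn; have := MUV a b an bn.
  rewrite (rk_exchange _ _ kl MN); case: (eqVneq a l) => [->|al]; last first.
    by rewrite addn0 WU.
  rewrite (dim_cap_hyperplane _ HU dU) WH /=.
  suff -> : (stage U l <= H + stage V b)%VS = (j < b)%N by lia.
  case: (ltnP j b) => jb.
    rewrite (hyperplane_line HU dU xU xH) addvS // -memvE.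
    by apply: subvP xV; exact: stageS.
  apply: contraNF xH => UHV; suff /subvP/(_ x xU) : (stage U l <= H)%VS by [].
  have UHVj : (stage U l <= H + stage V j)%VS.
    by apply: subv_trans UHV _; rewrite addvS // stageS // ltnW.
  rewrite -(capv_idPr UHVj) -vspace_modl // subv_add subvv /=.
  by apply: subv_trans SH; exact: addvSr.
by apply/convP; exists W => //; apply/(covers_orb kl _ rN NWV).
Qed.

(** If U_l lies in W_l + V_j, move a vector u of U_l outside W_l along the line
    u + tx, where x in W_{l+1} is not in W_l + V_j: for t <> 0 the flag becomes
    generic, and W does not change since X kills W_l and has image in W_{l+1}. *)
Lemma raise_closure mu : infinite_field F ->
  row_sums N = mu + delta_mx 0 l ->
  (conv (diag_mx mu + delta_mx k l) N : set (flag2 F n d)) `<=` closure (orb M).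
Proof.
move=> Finf rN [U V] /convP[W DUW NWV].
have [UW WU dU] := (covers_orb kl U rN NWV).1 DUW.
have [x [xW xV xn]] := orb_mem_gt0 NWV Nlj.
have generic U' : covers l U' W -> ~~ (stage U' l <= stage W l + stage V j)%VS -> orb M (U', V).
  move=> UW' nU'; apply: (raise_orb UW' NWV) => b bn; case: (ltnP j b) => jb.
    apply: subv_trans (raise_sub NWV jb bn); case: UW' => UW' _ _.
    by rewrite -UW' ?stageS // neq_ltn leqnn orbT.
  by apply: contraNF nU' => /subv_trans; apply; rewrite addvS // stageS // ltnW.
case: (boolP (stage U l <= stage W l + stage V j)%VS) => [sub|]; last first.
  by move=> nU; apply: subset_closure; exact: generic nU.
have [u uU uW] : exists2 u, u \in stage U l & u \notin stage W l.
  by apply/subvPn; apply: contraTN isT => /dimvS; rewrite dU ltnn.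
have uWV := subvP sub u uU.
have uS : u \notin (stage W l + <[x]>)%VS.
  apply: contraNN xn => /memv_addP[w wW [_ /vlineP[c ->] uE]].
  case: (eqVneq c 0) uE => [->|c0 uE]; first by rewrite scale0r addr0 => uE; rewrite uE wW in uW.
  have : c *: x \in (stage W l + stage V j)%VS.
    by rewrite -(addKr w (c *: x)) -uE memvD ?memvN // (subvP (addvSl _ _)).
  by move=> /(memvZ c^-1); rewrite scalerA mulVf // scale1r.
have [X [XX X0 Xu Xx]] := transvection_exists uS (subvP (addvSr _ _) x (memv_line x)).
apply: (closure_curve Finf (XX := XX)) => t t0.
have WX : flag_act W (transvection_unit t XX) = W.
  apply: flag_act_stable => a v an vW; rewrite mulmxDr mulmx1 -scalemxAr memvD // memvZ //.
  case: (leqP a l) => [al|la].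
    by rewrite X0 ?mem0v // (subvP (addvSl _ _)) // (subvP (stageS W al lnW)).
  by apply: (subvP _ _ (Xx v)); rewrite -memvE (subvP (stageS W la an)).
apply: generic.
  apply/(covers_orb kl _ rN NWV); rewrite -{1}WX.
  exact: orb_act.
apply: contra xn => /subvP/(_ _ (mem_flag_act (transvection_unit t XX) uU)).
rewrite mulmxDr mulmx1 -scalemxAr Xu => /(memvB)/(_ uWV); rewrite addrAC subrr add0r.
by move=> /(memvZ t^-1); rewrite scalerA mulVf // scale1r.
Qed.

Lemma circ_raise mu : infinite_field F ->
  N \in Mset n d -> row_sums N = mu + delta_mx 0 l ->
  circ F d (diag_mx mu + delta_mx k l) N = M.
Proof.
move=> Finf dN rN; apply: circ_eq; first by rewrite (Mset_exchange _ kl MN).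
- by rewrite col_sums_step.
- by move=> [U V]; exact: raise_conv.
- exact: raise_closure.
Qed.

End Raise.
End Steps.

(** * Shrinking one stage *)

Section Lower.
Variables (F : fieldType) (n d : nat).
Implicit Types (U W V : flag F n d) (D : 'M[nat]_n) (mu : 'rV[nat]_n).
Variables (k l j : 'I_n).
Hypothesis kl : l = k.+1 :> nat.
Variables (M N : 'M[nat]_n).
Hypothesis NM : N + delta_mx l j = M + delta_mx k j.
Hypothesis Nkj : (0 < N k j)%N.
Hypothesis Nk0 : forall j' : 'I_n, (j' < j)%N -> N k j' = 0%N.

Let ln : (l < n)%N. Proof. exact: ltn_ord. Qed.
Let lnW : (l <= n)%N. Proof. exact: ltnW. Qed.
Let kn : (k <= n)%N. Proof. exact/ltnW/ltn_ord. Qed.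
Let kll : (k <= l)%N. Proof. by rewrite kl. Qed.
Let kNl : k != l :> nat. Proof. by rewrite kl ltn_eqF. Qed.

Lemma lower_orb U W V : covers l W U -> orb N (W, V) ->
  (forall b, (b <= n)%N -> (stage W l <= stage U l + stage V b)%VS = (j < b)%N) ->
  orb M (U, V).
Proof.
move=> [WU UW dW] /orbP NWV WUV; apply/orbP => a b an bn.
have := NWV a b an bn; rewrite (rk_exchange _ _ kl NM); case: (eqVneq a l) => [->|al]; last first.
  by rewrite addn0 WU.
by rewrite (dim_cap_hyperplane _ UW dW) WUV //= => /addIn.
Qed.

(** As [M l j] is positive, U_{l+1} has a vector x in V_{j+1} that is not in
    U_l + V_j; enlarging U_l by x gives the intermediate flag. *)
Lemma lower_conv mu U V : row_sums N = mu + delta_mx 0 k -> orb M (U, V) ->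
  conv (diag_mx mu + delta_mx l k) N (U, V).
Proof.
clear Nkj Nk0; move=> rN MUV.
have Mlj : (0 < M l j)%N.
  have := congr1 (fun K : 'M_n => K l j) NM; rewrite !mxE !eqxx (_ : (l == k) = false) //=.
    by rewrite !natn; lia.
  by rewrite -val_eqE /= kl gtn_eqF.
have [x [xU xV xn]] := orb_mem_gt0 MUV Mlj.
have xUl : x \notin stage U l by apply: contraNN xn; exact: (subvP (addvSl _ _)).
have [|||W [WH WU]] := @flag_set _ _ _ U l (stage U l + <[x]>)%VS.
- by rewrite ln kl.
- by apply: subv_trans (addvSl _ _); rewrite stageS // leq_pred.
- by rewrite subv_add -memvE xU stageS.
have UW : covers l W U by split=> [//||]; rewrite WH ?addvSl // dimv_addl_line.
have NWV : orb N (W, V).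
  move: MUV => /orbP MUV; apply/orbP => a b an bn.
  rewrite (rk_exchange _ _ kl NM); case: (eqVneq a l) => [->|al]; last first.
    by rewrite addn0 WU // MUV.
  case: UW => _ UW dW; rewrite (dim_cap_hyperplane _ UW dW) MUV //=; congr (_ + nat_of_bool _)%N.
  rewrite WH subv_add addvSl -memvE /=; case: (ltnP j b) => jb.
    by apply: (subvP (addvSr _ _)); apply: subvP xV; exact: stageS.
  by apply: contraNF xn; apply/subvP; rewrite addvS // stageS // ltnW.
by apply/convP; exists W => //; apply/(covers_orb_tr kl _ rN NWV).
Qed.

(** Let y in W_l cap V_{j+1} be outside W_k.  The position is generic as soon as
    U_l avoids y.  If U_l contains y, choose w in W_l outside U_l and use the
    transvection that kills W_k and w and sends y to w: it tilts U_l away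
    from y, and it preserves W since its image is in W_l. *)
Lemma lower_closure mu : infinite_field F ->
  row_sums N = mu + delta_mx 0 k ->
  (conv (diag_mx mu + delta_mx l k) N : set (flag2 F n d)) `<=` closure (orb M).
Proof.
move=> Finf rN [U V] /convP[W DUW NWV].
have UW := (covers_orb_tr kl U rN NWV).1 DUW.
have [y [yW yV yn]] := orb_mem_gt0 NWV Nkj; rewrite -kl in yW.
have yk : y \notin stage W k by apply: contraNN yn; exact: (subvP (addvSl _ _)).
have WkU : (stage W k <= stage U l)%VS.
  by case: UW => WU _ _; rewrite WU // stageS.
have generic U' : covers l W U' -> y \notin stage U' l -> orb M (U', V).
  move=> UW' nU'; apply: (lower_orb UW' NWV) => b bn; case: UW' => WU' UW' dW'.
  case: (ltnP j b) => jb.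
    rewrite (hyperplane_line UW' dW' yW nU') addvS // -memvE.
    by apply: subvP yV; exact: stageS.
  have WVU : (stage W l :&: stage V b <= stage U' l)%VS.
    have /eqP <- : (stage W k :&: stage V b == stage W l :&: stage V b)%VS.
      rewrite eqEdim capvS ?stageS //=; move/orbP: NWV => NWV; rewrite !NWV // kl rkS.
      rewrite big1 // => j' j'b; apply: Nk0; exact: leq_trans jb.
    apply: subv_trans (capvSl _ _) _.
    by rewrite WU' // stageS.
  apply/negbTE; apply: contraTN isT => sub; have := dim_cap_hyperplane (stage V b) UW' dW'.
  by rewrite sub (_ : stage W l :&: stage V b = stage U' l :&: stage V b)%VS; [lia|];
    apply/eqP; rewrite eqEsubv subv_cap WVU capvSr capvS.
case: (boolP (y \in stage U l)) => [yU|]; last first.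
  by move=> nU; apply: subset_closure; exact: generic nU.
have [WU UWl dW] := UW.
have [w wW wU] : exists2 w, w \in stage W l & w \notin stage U l.
  by apply/subvPn; apply: contraTN isT => /dimvS; rewrite dW ltnn.
have yS : y \notin (stage W k + <[w]>)%VS.
  apply: contraNN yk => /memv_addP[v vW [_ /vlineP[c ->] yE]].
  case: (eqVneq c 0) yE => [->|c0 yE]; first by rewrite scale0r addr0 => ->.
  have : c *: w \in stage U l by rewrite -(addKr v (c *: w)) -yE memvD ?memvN // (subvP WkU).
  by move=> /(memvZ c^-1); rewrite scalerA mulVf // scale1r (negPf wU).
have [X [XX X0 Xy Xw]] := transvection_exists yS (subvP (addvSr _ _) w (memv_line w)).
apply: (closure_curve Finf (XX := XX)) => t t0.
have WX : flag_act W (transvection_unit t XX) = W.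
  apply: flag_act_stable => a v an vW; rewrite mulmxDr mulmx1 -scalemxAr memvD // memvZ //.
  case: (ltnP a l) => [al|la].
    rewrite X0 ?mem0v // (subvP (addvSl _ _)) //; apply: subvP vW; apply: stageS.
      by rewrite -ltnS -kl.
    exact: ltnW.
  by apply: (subvP _ _ (Xw v)); rewrite -memvE (subvP (stageS W la an)).
apply: generic.
  apply/(covers_orb_tr kl _ rN NWV); rewrite -{1}WX.
  exact: orb_act.
apply: contra wU; rewrite /stage flag_actE => /memv_imgP[z zU]; rewrite lactE.
rewrite mulmxDr mulmx1 -scalemxAr => yE.
have zX : z *m X = w.
  by rewrite -Xy yE mulmxDl -scalemxAl -mulmxA XX mulmx0 scaler0 addr0.
have : t *: w \in U (inord l) by rewrite -zX -(addKr z (t *: _)) -yE memvD ?memvN.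
by move=> /(memvZ t^-1); rewrite scalerA mulVf // scale1r.
Qed.

Lemma circ_lower mu : infinite_field F ->
  N \in Mset n d -> row_sums N = mu + delta_mx 0 k ->
  circ F d (diag_mx mu + delta_mx l k) N = M.
Proof.
move=> Finf dN rN; apply: circ_eq; first by rewrite -(Mset_exchange _ kl NM).
- by rewrite col_sums_step.
- by move=> [U V]; exact: lower_conv.
- exact: lower_closure.
Qed.

End Lower.

(** * Bruhat order and the factorization *)

Section Moves.
Variable n : nat.
Implicit Types (K M N : 'M[nat]_n) (k l j : 'I_n) (mu : 'rV[nat]_n).

(** One unit of column [j] moves from row [k] to row [l]; the truncated
    subtraction is exact when [K k j] is positive. *)
Definition move_unit K k l j : 'M[nat]_n :=
  \matrix_(i, i') (K i i' + ((i == l) && (i' == j)) - ((i == k) && (i' == j)))%N.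

Lemma move_unitE K k l j : k != l -> (0 < K k j)%N ->
  move_unit K k l j + delta_mx k j = K + delta_mx l j.
Proof.
move=> kl Kkj; apply/matrixP => i i'; rewrite !mxE !natn; apply: subnK.
case: eqVneq => [->|] //=; case: eqVneq => [->|] //=; by lia.
Qed.

Lemma addmx_natI K M N : M + K = N + K -> M = N.
Proof.
move=> /matrixP MN; apply/matrixP => i j; have := MN i j; rewrite !mxE; exact: addIn.
Qed.

Lemma diag_normD M N : diag_norm (M + N) = (diag_norm M + diag_norm N)%N.
Proof.
rewrite /diag_norm -big_split; apply: eq_bigr => i _; rewrite -big_split.
by apply: eq_bigr => j _; rewrite mxE mulnDr.
Qed.

Lemma diag_norm_delta k j : diag_norm (delta_mx k j) = `|k - j|%N.
Proof.
rewrite /diag_norm (bigD1 k) //= (bigD1 j) //= !mxE !eqxx !big1 ?addn0 ?muln1 //.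
  by move=> i /negPf ik; rewrite big1 // => i' _; rewrite mxE ik muln0.
by move=> i /negPf ij; rewrite mxE ij andbF muln0.
Qed.

Lemma row_sums_gt0 M i j : (0 < M i j)%N -> (0 < row_sums M 0%R i)%N.
Proof. by move=> Mij; rewrite mxE (bigD1 j) //= addn_gt0 Mij. Qed.

Lemma row_sums_sub M i : (0 < row_sums M 0%R i)%N ->
  exists mu, row_sums M = mu + delta_mx 0 i.
Proof.
move=> Mi; exists (\row_i' (row_sums M 0%R i' - (i' == i))%N).
apply/rowP => i'; rewrite !mxE natn; apply/esym/subnK.
by case: eqVneq => // ->; rewrite mxE in Mi.
Qed.

Lemma sum_row_sums d M mu i : M \in Mset n d -> row_sums M = mu + delta_mx 0 i ->
  (\sum_i mu 0%R i).+1 = d.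
Proof.
rewrite inE => /eqP <- rM; rewrite -addn1.
rewrite [RHS](eq_bigr (fun i => row_sums M 0%R i)) => [|i' _]; last by rewrite mxE.
rewrite rM [RHS](eq_bigr (fun i' => mu 0%R i' + (i' == i))%N) => [|i' _].
  rewrite big_split /=; congr (_ + _)%N; rewrite (bigD1 i) //= eqxx big1 ?addn0 //.
  by move=> i' /negPf ->.
by rewrite !mxE natn.
Qed.

Lemma row_sum_neq0 M i : (0 < row_sums M 0%R i)%N -> exists j, (0 < M i j)%N.
Proof.
move=> Mi; apply/existsP; apply: contraTT Mi; rewrite negb_exists => /forallP M0.
rewrite mxE big1 // => j _; have := M0 j; by rewrite -leqNgt leqn0 => /eqP.
Qed.

End Moves.

Section Bruhat.
Variables (F : fieldType) (n d : nat).
Implicit Types (D L M N P : 'M[nat]_n).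

Lemma closed_dim1 (a : 'I_n.+1) r : closed [set x : flag2 F n d | \dim (x.1 a) = r].
Proof.
apply/flag2_closedE => p q; exists (if p a == r then setT else set0).
  by case: ifP => _; [exact: affine_closedT | exact: affine_closed0].
by move=> U W g h Up _ _ _ /=; rewrite Up; case: eqP.
Qed.

(** The dimensions of the spaces of the first flag are locally constant. *)
Lemma bruhat_row_sums L N : bruhat_lt F d L N -> row_sums L = row_sums N.
Proof.
move=> [dL _ LN]; have [[U V] LUV] := orb_nonempty F dL; have [+ _] := LN _ LUV.
rewrite closureE => NUV.
have rkE a : (a <= n)%N -> rk L a n = rk N a n.
  move=> an; rewrite -(orb_stage_dim1 LUV an).
  pose Z := [set x : flag2 F n d | \dim (stage x.1 a) = rk N a n].
  suff : Z (U, V) by [].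
  apply: NUV; split; first exact: closed_dim1.
  by move=> [U' V'] NUV'; rewrite /Z /mkset (orb_stage_dim1 NUV').
apply/rowP => i; have := rkE i.+1 (ltn_ord i); rewrite !rk_row_sums !sum_ltS.
by rewrite -!rk_row_sums rkE ?(ltnW (ltn_ord i)) // => /addIn.
Qed.

Lemma bruhat_rk L N a b : bruhat_lt F d L N -> (a <= n)%N -> (b <= n)%N ->
  (rk N a b <= rk L a b)%N.
Proof.
move=> [dL _ LN] an bn; have [x Lx] := orb_nonempty F dL; have [Nx _] := LN x Lx.
by have := closure_orb_rk (inord a) (inord b) Nx Lx; rewrite !inordK.
Qed.

Lemma bruhat_neq L N : bruhat_lt F d L N -> L <> N.
Proof.
move=> [dL _ LN] eLN; have [x Lx] := orb_nonempty F dL; have [_] := LN x Lx.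
by rewrite -eLN.
Qed.

(** Strictness comes for free from [P <> M], since distinct orbits are disjoint. *)
Lemma bruhat_conv D L N P M : P \in Mset n d -> M \in Mset n d ->
  bruhat_lt F d L N ->
  (orb P : set (flag2 F n d)) `<=` conv D L ->
  (conv D N : set (flag2 F n d)) `<=` closure (orb M) ->
  P <> M -> bruhat_lt F d P M.
Proof.
move=> dP dM [dL dN LN] PDL DNM PM; split=> // -[U V] PUV; split; last first.
  by move=> MUV; apply: PM; exact: orb_disjoint PUV MUV.
have /convP[W DUW LWV] := PDL _ PUV.
have [NWV _] := LN _ LWV.
have := closure_conv DUW NWV => /(closureS DNM).
by have /closure_id <- := @closed_closure (flag2 F n d) (orb M).
Qed.

End Bruhat.

Section Factor.
Variables (F : fieldType) (n d : nat).
Hypothesis Finf : infinite_field F.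
Implicit Types (D L M N P : 'M[nat]_n).

Definition factorization M D N :=
  [/\ D \in Mset n d /\ N \in Mset n d, almost_diagonal d D, circ F d D N = M,
      (diag_norm N < diag_norm M)%N
    & forall L, bruhat_lt F d L N -> bruhat_lt F d (circ F d D L) M].

Lemma Mset_step (mu : 'rV[nat]_n) (k l : 'I_n) :
  (\sum_i mu 0%R i).+1 = d -> diag_mx mu + delta_mx k l \in Mset n d.
Proof.
move=> <-; rewrite MsetE rkD rk_diag rk_delta !ltn_ord minnn /= addn1 eqSS; apply/eqP.
by apply: eq_bigl => i; rewrite ltn_ord.
Qed.

(** Here [j] is the last column with an entry above the diagonal. *)
Lemma factor_upper M (k j : 'I_n) : M \in Mset n d -> (k < j)%N -> (0 < M k j)%N ->
  (forall i i' : 'I_n, (i < i')%N -> (0 < M i i')%N -> (i' <= j)%N) ->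
  exists D N, factorization M D N.
Proof.
move=> dM kj Mkj jmax.
pose l : 'I_n := Ordinal (leq_ltn_trans kj (ltn_ord j)).
have kl : l = k.+1 :> nat by [].
have kNl : k != l by rewrite -val_eqE /= ltn_eqF.
pose N := move_unit M k l j.
have MN : M + delta_mx l j = N + delta_mx k j by rewrite move_unitE.
have dN : N \in Mset n d by rewrite -(Mset_exchange _ kl MN).
have Nlj : (0 < N l j)%N.
  by rewrite mxE !eqxx /= eq_sym (negPf kNl) subn0 addn1.
have Nl0 (j' : 'I_n) : (j < j')%N -> N l j' = 0%N.
  move=> jj'; have jNj : (j' == j) = false by rewrite -val_eqE gtn_eqF.
  rewrite mxE jNj !andbF addn0 subn0; apply/eqP; rewrite -leqn0 leqNgt.
  apply/negP => M0; have lj' : (l < j')%N by apply: leq_ltn_trans jj'.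
  by have := jmax _ _ lj' M0; rewrite leqNgt jj'.
have Nl := row_sums_gt0 Nlj; have [mu rN] := row_sums_sub Nl.
have smu := sum_row_sums dN rN.
exists (diag_mx mu + delta_mx k l), N; split.
- by split=> //; exact: Mset_step.
- by exists mu, k, l; split=> //; left.
- exact: (circ_raise kl MN Nlj Nl0 Finf dN rN).
- have := congr1 (@diag_norm n) MN; rewrite !diag_normD !diag_norm_delta /=.
  by lia.
move=> L LN; have [dL _ _] := LN; have rL := bruhat_row_sums LN.
have [j0 Lj0] : exists j', (0 < L l j')%N by apply: row_sum_neq0; rewrite rL.
have [j' Lj' j'max] := @arg_maxnP _ j0 (fun j' => 0 < L l j')%N (fun j' => j') Lj0.
have Ll0 (i : 'I_n) : (j' < i)%N -> L l i = 0%N.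
  by move=> j'i; apply/eqP; rewrite -leqn0 leqNgt; apply: contraTN j'i => /j'max; rewrite -leqNgt.
pose P := move_unit L l k j'.
have PL : P + delta_mx l j' = L + delta_mx k j' by rewrite move_unitE // eq_sym.
rewrite rN in rL.
rewrite (circ_raise kl PL Lj' Ll0 Finf dL rL).
apply: (bruhat_conv _ dM LN (D := diag_mx mu + delta_mx k l)).
- by rewrite (Mset_exchange _ kl PL).
- by move=> [U V]; exact: (raise_conv kl PL rL).
- exact: (raise_closure kl MN Nlj Nl0 Finf rN).
move=> PM; rewrite PM in PL.
(* The ranks at (l, j' + 1) would otherwise be smaller for L than for N. *)
have jj' : (j <= j')%N.
  have := bruhat_rk LN (ltnW (ltn_ord l)) (ltn_ord j').
  have := rk_exchange l j'.+1 kl MN; have := rk_exchange l j'.+1 kl PL.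
  by rewrite eqxx ltnSn /=; case: (ltnP j j'.+1) => [//|_]; lia.
have Mkj' : (0 < M k j')%N.
  have := congr1 (fun K : 'M_n => K k j') PL; rewrite !mxE !eqxx (negPf kNl) !natn /=; lia.
have j'j : (j' <= j)%N by apply: jmax Mkj'; exact: leq_trans jj'.
have ejj : j' = j by apply/val_inj/anti_leq; rewrite jj' j'j.
apply: (bruhat_neq LN); rewrite ejj in PL.
by apply: (addmx_natI (K := delta_mx k j)); rewrite -PL MN.
Qed.

(** Here [j] is the first column with an entry below the diagonal. *)
Lemma factor_lower M (l j : 'I_n) : M \in Mset n d -> (j < l)%N -> (0 < M l j)%N ->
  (forall i i' : 'I_n, (i' < i)%N -> (0 < M i i')%N -> (j <= i')%N) ->
  exists D N, factorization M D N.
Proof.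
move=> dM jl Mlj jmin.
pose k : 'I_n := Ordinal (leq_ltn_trans (leq_pred l) (ltn_ord l)).
have kl : l = k.+1 :> nat by rewrite /= prednK // (leq_ltn_trans _ jl).
have kNl : k != l by rewrite -val_eqE /= kl ltn_eqF //= ltnS.
have jk : (j <= k)%N by rewrite -ltnS -kl.
pose N := move_unit M l k j.
have NM : N + delta_mx l j = M + delta_mx k j by rewrite move_unitE // eq_sym.
have dN : N \in Mset n d by rewrite (Mset_exchange _ kl NM).
have Nkj : (0 < N k j)%N.
  by rewrite mxE !eqxx /= (negPf kNl) subn0 addn1.
have Nk0 (j' : 'I_n) : (j' < j)%N -> N k j' = 0%N.
  move=> jj'; have jNj : (j' == j) = false by rewrite -val_eqE ltn_eqF.
  rewrite mxE jNj !andbF addn0 subn0; apply/eqP; rewrite -leqn0 leqNgt.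
  apply/negP => M0; have j'k : (j' < k)%N by apply: leq_trans jk.
  by have := jmin _ _ j'k M0; rewrite leqNgt jj'.
have Nk := row_sums_gt0 Nkj; have [mu rN] := row_sums_sub Nk.
have smu := sum_row_sums dN rN.
exists (diag_mx mu + delta_mx l k), N; split.
- by split=> //; exact: Mset_step.
- by exists mu, k, l; split=> //; right.
- exact: (circ_lower kl NM Nkj Nk0 Finf dN rN).
- have := congr1 (@diag_norm n) NM; rewrite !diag_normD !diag_norm_delta /=.
  by lia.
move=> L LN; have [dL _ _] := LN; have rL := bruhat_row_sums LN.
have [j0 Lj0] : exists j', (0 < L k j')%N by apply: row_sum_neq0; rewrite rL.
have [j' Lj' j'min] := @arg_minnP _ j0 (fun j' => 0 < L k j')%N (fun j' => j') Lj0.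
have Lk0 (i : 'I_n) : (i < j')%N -> L k i = 0%N.
  by move=> j'i; apply/eqP; rewrite -leqn0 leqNgt; apply: contraTN j'i => /j'min; rewrite -leqNgt.
pose P := move_unit L k l j'.
have LP : L + delta_mx l j' = P + delta_mx k j' by rewrite move_unitE.
rewrite rN in rL.
rewrite (circ_lower kl LP Lj' Lk0 Finf dL rL).
apply: (bruhat_conv _ dM LN (D := diag_mx mu + delta_mx l k)).
- by rewrite -(Mset_exchange _ kl LP).
- by move=> [U V]; exact: (lower_conv kl LP rL).
- exact: (lower_closure kl NM Nkj Nk0 Finf rN).
move=> PM; rewrite PM in LP.
(* The ranks at (l, j + 1) would otherwise be smaller for L than for N. *)
have j'j : (j' <= j)%N.
  have := bruhat_rk LN (ltnW (ltn_ord l)) (ltn_ord j).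
  have := rk_exchange l j.+1 kl NM; have := rk_exchange l j.+1 kl LP.
  by rewrite eqxx ltnSn /=; case: (ltnP j' j.+1) => [//|_]; lia.
have Mlj' : (0 < M l j')%N.
  have := congr1 (fun K : 'M_n => K l j') LP; rewrite !mxE !eqxx eq_sym (negPf kNl) !natn /=; lia.
have jj' : (j <= j')%N by apply: jmin Mlj'; exact: leq_ltn_trans jl.
have ejj : j' = j by apply/val_inj/anti_leq; rewrite jj' j'j.
apply: (bruhat_neq LN); rewrite ejj in LP.
by apply: (addmx_natI (K := delta_mx l j)); rewrite LP NM.
Qed.

Lemma factor_exists M : M \in Mset n d -> (0 < diag_norm M)%N ->
  exists D N, factorization M D N.
Proof.
move=> dM M0.
case: (pickP [pred p : 'I_n * 'I_n | (p.1 < p.2) && (0 < M p.1 p.2)]%N) => [p0 Pp0|up].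
  have [[k j] /= /andP[kj Mkj] jmax] := @arg_maxnP _ p0 _ (fun p => p.2) Pp0.
  apply: (factor_upper dM kj Mkj) => i i' ii' Mii'.
  by apply: (jmax (i, i')); rewrite /= ii'.
case: (pickP [pred p : 'I_n * 'I_n | (p.2 < p.1) && (0 < M p.1 p.2)]%N) => [p0 Pp0|lo].
  have [[l j] /= /andP[lj Mlj] jmin] := @arg_minnP _ p0 _ (fun p => p.2) Pp0.
  apply: (factor_lower dM lj Mlj) => i i' ii' Mii'.
  by apply: (jmin (i, i')); rewrite /= ii'.
move: M0; rewrite lt0n /diag_norm big1 // => i _; rewrite big1 // => j _.
have := up (i, j); have := lo (i, j); rewrite /=.
case: (posnP (M i j)) => [->|]; first by rewrite muln0.
case: (ltngtP i j) => //= /val_inj -> _ _ _; lia.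
Qed.

End Factor.

Lemma infinite_numField (F : numFieldType) : infinite_field F.
Proof.
move=> s.
pose t : seq F := [seq i%:R | i <- iota 0 (size s).+1].
have ut : uniq t.
  by rewrite map_inj_uniq ?iota_uniq // => i j /eqP; rewrite eqr_nat => /eqP.
have /allPn[a _ as_] : ~~ all (mem s) t.
  apply/negP => /allP ts; have := uniq_leq_size ut ts.
  by rewrite size_map size_iota ltnn.
by exists a.
Qed.

Theorem corollary2p27 (R : realType) (n d : nat) (hn : (0 < n)%N) (hd : (0 < d)%N)
    (M : 'M[nat]_n) (hM : M \in Mset n d) (hnorm : (0 < diag_norm M)%N) :
  exists D N : 'M[nat]_n,
    [/\ D \in Mset n d /\ N \in Mset n d,
        almost_diagonal d D,
        circ R[i] d D N = M,
        (diag_norm N < diag_norm M)%N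
      & forall L : 'M[nat]_n,
          bruhat_lt R[i] d L N -> bruhat_lt R[i] d (circ R[i] d D L) M].
Proof. exact: (factor_exists (F := R[i]) (@infinite_numField R[i]) hM hnorm). Qed.
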